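(* Let $(M^{2n},\omega,\mathbb{T},\psi)$ be a symplectic toric manifold, and let $\mu=\langle\psi,\overline{\xi}\rangle\colon M\to\mathbb{R}$ be a generic component of the moment map. Let $\Gamma^o=(V,E^o)$ be the associated oriented GKM graph, and assume it is index increasing. Then for each $p\in M^{\mathbb{T}}$ the equivariant K-theoretical Poincaré dual $\eta_p\in\mathcal{K}_{\mathbb{T}}(M)$ to the flow-up manifold $F_p$ is the i-canonical class $\tau_p$ at $p$.
   Context: Setting. A symplectic toric manifold $(M,\omega,\mathbb{T},\psi)$ of dimension $2n$ is a compact connected symplectic manifold $(M^{2n},\omega)$ with an effective Hamiltonian action of an $n$-dimensional torus $\mathbb{T}$ with Lie algebra $\mathfrak{t}$ and moment map $\psi\colon M\to\mathfrak{t}^*$ ($\mathbb{T}$-invariant, $\iota_{\xi^\#}\omega=-d\langle\psi,\xi\rangle$ for $\xi\in\mathfrak{t}$). The fixed point set $M^{\mathbb{T}}$ is discrete. Let $\ell^*\subset\mathfrak{t}^*$ be the weight lattice; $w\in\ell^*$ corresponds to the character $\exp(\xi)\mapsto e^{2\pi i w(\xi)}$. Let $J$ be a $\mathbb{T}$-invariant almost complex structure such that $\omega(J\cdot,\cdot)$ is an inner product; for $p\in M^{\mathbb{T}}$ let $W_p$ be the set of weights of the isotropy representation of $\mathbb{T}$ on $(T_pM,J)\simeq\mathbb{C}^n$; it is a $\mathbb{Z}$-basis of $\ell^*$. Generic component. $\overline{\xi}\in\mathfrak{t}$ is generic if $w(\overline{\xi})\ne0$ for all isotropy weights $w\in\bigcup_pW_p$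 and $\mu=\langle\psi,\overline{\xi}\rangle$ takes distinct values at distinct fixed points; then $\mu$ is called a generic component of the moment map. Put $W_p^{\pm}=\{w\in W_p:\pm w(\overline{\xi})>0\}$ and $\lambda_p=|W_p^+|$. With these conventions $W_p^+$ is the set of weights on the negative normal bundle of the Morse function $\mu$ at $p$. GKM graph. $\Gamma=(V,E)$ has $V=M^{\mathbb{T}}$ (identified with the vertices of the polytope $\psi(M)$) and a directed edge $\overrightarrow{r\,q}$ in each direction for every edge of $\psi(M)$; $w(\overrightarrow{r\,q})\in\ell^*$ is the weight of $\mathbb{T}$ on the tangent space at $q$ of the invariant sphere over that edge, equivalently the primitive element of $\ell^*$ with $\psi(q)-\psi(r)=m\,w(\overrightarrow{r\,q})$, $m>0$. The oriented GKM graph $\Gamma^o=(V,E^o)$ keeps the edges $\overrightarrow{r\,q}$ with $\mu(r)<\mu(q)$. It is index increasing if $\lambda_r<\lambda_q$ for every $\overrightarrow{r\,q}\in E^o$. Flow-up. $F_p=\psi^{-1}\big((\psi(p)+\mathrm{span}_{\mathbb{R}}W_p^-)\cap\psi(M)\big)$, a closed $\mathbb{T}$-invariant symplectic submanifold of dimension $2(n-\lambda_p)$. K-theory. $\mathcal{K}_{\mathbb{T}}(M)$ is the Grothendieck ring of complex $\mathbb{T}$-vector bundles over $M$; $R(\mathbb{T})=\mathcal{K}_{\mathbb{T}}(\mathrm{pt})$ is the representation ring, identified with finite sums $\sum n_je^{2\pi i w_j}$, $n_j\in\mathbb{Z}$, $w_j\in\ell^*$. For $\tau\in\mathcal{K}_{\mathbb{T}}(M)$,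 $\tau(p)\in R(\mathbb{T})$ is its restriction to $p\in M^{\mathbb{T}}$; restriction to $M^{\mathbb{T}}$ is injective, so $\mathcal{K}_{\mathbb{T}}(M)$ is regarded as a subring of $\bigoplus_{p\in M^{\mathbb{T}}}R(\mathbb{T})$. Poincaré dual. $\eta_p\in\mathcal{K}_{\mathbb{T}}(M)$ is the class with $\eta_p(q)=0$ for $q\in M^{\mathbb{T}}\setminus F_p$ and $\eta_p(q)=\prod_{r\in M^{\mathbb{T}}\setminus F_p,\ \overrightarrow{r\,q}\in E}(1-e^{2\pi i w(\overrightarrow{r\,q})})$ for $q\in F_p\cap M^{\mathbb{T}}$. Kirwan class. $\nu\in\mathcal{K}_{\mathbb{T}}(M)$ is a Kirwan class at $p$ if $\nu(p)=\prod_{w\in W_p^+}(1-e^{2\pi i w})$ and $\nu(q)=0$ for every $q\in M^{\mathbb{T}}$ with $\mu(q)<\mu(p)$. Local index. Let $q\in M^{\mathbb{T}}$, $\lambda=\lambda_q$, $W_q^+=\{w_1,\dots,w_\lambda\}$, $W_q^-=\{w_{\lambda+1},\dots,w_n\}$. Let $w_0$ be a further generator, so that $w_0,w_1,\dots,w_n$ is a $\mathbb{Z}$-basis of the weight lattice of $\mathbb{T}\times S^1$. Given $\tau\in\mathcal{K}_{\mathbb{T}}(M)$ write $\tau(q)=f(e^{2\pi i w_1},\dots,e^{2\pi i w_n})$ with $f$ a Laurent polynomial with integer coefficients, and put $$f_0=f(e^{2\pi i(w_0+w_1)},\dots,e^{2\pi i(w_0+w_\lambda)},e^{2\pi i w_{\lambda+1}},\dots,e^{2\pi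 i w_n}),$$ $$f_j=f(e^{2\pi i(w_1-w_j)},\dots,e^{2\pi i(w_\lambda-w_j)},e^{2\pi i w_{\lambda+1}},\dots,e^{2\pi i w_n}),\quad 1\le j\le\lambda.$$ These are the fixed-point restrictions of a class in the equivariant K-theory of $\mathbb{C}\mathbb{P}^{\lambda}$, where the torus acts with isotropy weights $\{w_0+w_k\}_{1\le k\le\lambda}$ at the $0$-th fixed point and $\{-(w_j+w_0)\}\cup\{w_k-w_j\}_{1\le k\le\lambda,\,k\ne j}$ at the $j$-th. The local index $\mathrm{Ind}_q(\tau)\in R(\mathbb{T})$ is the image, under the ring homomorphism sending $w_0$ to $0$ and fixing $w_1,\dots,w_n$, of the K-theoretic push-forward to a point of this class, i.e. of $$\frac{f_0}{\prod_{k=1}^{\lambda}(1-e^{2\pi i(w_k+w_0)})}+\sum_{j=1}^{\lambda}\frac{f_j}{(1-e^{-2\pi i(w_j+w_0)})\prod_{1\le k\le\lambda,\,k\neq j}(1-e^{2\pi i(w_k-w_j)})},$$ which is a Laurent polynomial in the exponentials. (If $\lambda=0$ then $\mathrm{Ind}_q(\tau)=\tau(q)$.) i-canonical class. An i-canonical class at $p$ is a Kirwan class $\tau_p\in\mathcal{K}_{\mathbb{T}}(M)$ at $p$ with $\mathrm{Ind}_q(\tau_p)=1$ for all $q\in F_p\cap M^{\mathbb{T}}$ and $\mathrm{Ind}_q(\tau_p)=0$ for all $q\in M^{\mathbb{T}}\setminus F_p$; it is unique if it exists. *)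

(* Defs.v *)
From HB Require Import structures.
From mathcomp Require Import all_boot all_order all_algebra.
From mathcomp Require Import all_classical all_reals all_analysis.
From mathcomp Require Import finmap.
From mathcomp.real_closed Require Import complex.
Import numFieldNormedType.Exports.
Set Implicit Arguments.
Unset Strict Implicit.
Unset Printing Implicit Defensive.
Import Order.TTheory GRing.Theory Num.Theory.
Local Open Scope classical_set_scope.
Local Open Scope ring_scope.

(* The torus is T = R^n / Z^n: its Lie algebra t and the dual t* are 'rV[R]_n,
   paired by the dot product, the kernel of exp : t -> T is Z^n, and the weight
   lattice l* is 'rV[int]_n. *)

(* R[i] seen as a numClosedFieldType, from which it gets its topology. *)
Definition Cx (R : realType) : numClosedFieldType := R[i].

Definition dot (R : realType) n (a b : 'rV[R]_n) : R := (a *m b^T) 0 0.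

Definition intv (R : realType) n (w : 'rV[int]_n) : 'rV[R]_n :=
  map_mx intr w.

Definition wdot (R : realType) n (w : 'rV[int]_n) (xi : 'rV[R]_n) : R :=
  dot (intv R w) xi.

(* exp (2 i pi x) *)
Definition expi (R : realType) (x : R) : Cx R :=
  (cos (2 * pi * x) +i* sin (2 * pi * x))%C.

(* The character exp xi |-> exp (2 i pi w(xi)). *)
Definition chi (R : realType) n (w : 'rV[int]_n) (xi : 'rV[R]_n) : Cx R :=
  expi (wdot w xi).

(* f is of class C^k on U; only meant for U open. *)
Fixpoint Ck (R : realType) (V W : normedModType R) (k : nat) (U : set V)
    (f : V -> W) : Prop :=
  match k with
  | 0 => forall x, U x -> {for x, continuous f}
  | k'.+1 => (forall x, U x -> differentiable f x) /\
             (forall v, Ck k' U (fun x => 'D_v f x))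
  end.

Definition smooth (R : realType) (V W : normedModType R) (U : set V)
  (f : V -> W) : Prop := forall k, Ck k U f.

(* cmap i is a chart on dom i, and cinv i its inverse; their values outside
   dom i and its image are irrelevant. *)
Record atlas (R : realType) (d : nat) (M : topologicalType) := Atlas {
  chart : Type;
  dom : chart -> set M;
  cmap : chart -> M -> 'rV[R]_d;
  cinv : chart -> 'rV[R]_d -> M;
  dom_open : forall i, open (dom i);
  dom_cover : forall x, exists i, dom i x;
  img_open : forall i, open (cmap i @` dom i);
  cmapK : forall i x, dom i x -> cinv i (cmap i x) = x;
  cmap_continuous : forall i x, dom i x -> {for x, continuous (cmap i)};
  cinv_continuous : forall i x, dom i x ->
    {for cmap i x, continuous (cinv i)};
  transition_smooth : forall i j,
    smooth (cmap i @` (dom i `&` dom j)) (fun y => cmap j (cinv i y)) }.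

Definition img (R : realType) d (M : topologicalType) (A : atlas R d M)
  (i : chart A) : set 'rV[R]_d := cmap i @` dom i.

(* Value on (u, v) of the bilinear form with matrix B. *)
Definition bform (R : realType) d (B : 'M[R]_d) (u v : 'rV[R]_d) : R :=
  (u *m B *m v^T) 0 0.

(* om i y is the matrix of the 2-form at the point with coordinates y in the
   chart i. *)
Record is_symplectic (R : realType) d (M : topologicalType) (A : atlas R d M)
    (om : chart A -> 'rV[R]_d -> 'M[R]_d) : Prop := IsSymplectic {
  om_smooth : forall i, smooth (img i) (om i);
  om_skew : forall i y, img i y -> (om i y)^T = - om i y;
  om_nondegenerate : forall i y, img i y -> om i y \in unitmx;
  om_compat : forall i j x u v, dom i x -> dom j x ->
    let T := fun y => cmap j (cinv i y) in
    bform (om i (cmap i x)) u v =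
      bform (om j (cmap j x)) ('D_u T (cmap i x)) ('D_v T (cmap i x));
  (* d om (u, v, w) = 0 for constant vector fields u, v, w in a chart *)
  om_closed : forall i y u v w, img i y ->
    'D_u (fun z => bform (om i z) v w) y + 'D_v (fun z => bform (om i z) w u) y
      + 'D_w (fun z => bform (om i z) u v) y = 0 }.

(* A smooth effective action of R^n / Z^n, as an action of R^n. *)
Record is_torus_action (R : realType) n d (M : topologicalType)
    (A : atlas R d M) (tact : 'rV[R]_n -> M -> M) : Prop := IsTorusAction {
  act_add : forall xi zeta x, tact (xi + zeta) x = tact xi (tact zeta x);
  act_int : forall (w : 'rV[int]_n) x, tact (intv R w) x = x;
  act_effective : forall xi, (forall x, tact xi x = x) ->
    exists w : 'rV[int]_n, xi = intv R w;
  act_continuous : continuous (fun z : 'rV[R]_n * M => tact z.1 z.2);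
  act_smooth : forall i j : chart A,
    smooth [set z : 'rV[R]_n * 'rV[R]_d |
              img i z.2 /\ dom j (tact z.1 (cinv i z.2))]
      (fun z => cmap j (tact z.1 (cinv i z.2))) }.

Definition action_preserves (R : realType) n d (M : topologicalType)
    (A : atlas R d M) (tact : 'rV[R]_n -> M -> M)
    (om : chart A -> 'rV[R]_d -> 'M[R]_d) : Prop :=
  forall i j xi x u v, dom i x -> dom j (tact xi x) ->
    let T := fun y => cmap j (tact xi (cinv i y)) in
    bform (om i (cmap i x)) u v =
      bform (om j (cmap j (tact xi x)))
        ('D_u T (cmap i x)) ('D_v T (cmap i x)).

(* The last field is iota_{xi#} om = - d <psi, xi>, where xi# is the vector
   field generated by xi. *)
Record is_moment_map (R : realType) n d (M : topologicalType)
    (A : atlas R d M) (om : chart A -> 'rV[R]_d -> 'M[R]_d)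
    (tact : 'rV[R]_n -> M -> M) (psi : M -> 'rV[R]_n) : Prop := IsMomentMap {
  psi_smooth : forall i : chart A, smooth (img i) (fun y => psi (cinv i y));
  psi_invariant : forall xi x, psi (tact xi x) = psi x;
  psi_hamiltonian : forall (i : chart A) x xi v, dom i x ->
    bform (om i (cmap i x)) ('D_xi (fun zeta => cmap i (tact zeta x)) 0) v =
      - 'D_v (fun y => dot (psi (cinv i y)) xi) (cmap i x) }.

Record symplectic_toric_manifold (R : realType) (n : nat) :=
  SymplecticToricManifold {
  mspace : topologicalType;
  space_hausdorff : hausdorff_space mspace;
  space_compact : compact [set: mspace];
  space_connected : connected [set: mspace];
  charts : atlas R n.*2 mspace;
  omega : chart charts -> 'rV[R]_n.*2 -> 'M[R]_n.*2;
  omega_symplectic : is_symplectic omega;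
  tact : 'rV[R]_n -> mspace -> mspace;
  act_torus : is_torus_action charts tact;
  act_symplectic : action_preserves tact omega;
  psi : mspace -> 'rV[R]_n;
  psi_moment : is_moment_map omega tact psi }.

(* J i y is the matrix, acting on row vectors, of the almost complex structure
   at the point with coordinates y in the chart i. *)
Definition acs_field (R : realType) n (X : symplectic_toric_manifold R n) :=
  chart (charts X) -> 'rV[R]_n.*2 -> 'M[R]_n.*2.

(* acs_invariant with xi = 0 is compatibility with the changes of charts. *)
Record invariant_compatible_acs (R : realType) n
    (X : symplectic_toric_manifold R n) (J : acs_field X) : Prop :=
  InvariantCompatibleAcs {
  acs_smooth : forall i, smooth (img i) (J i);
  acs_square : forall i y, img i y -> J i y *m J i y = - 1%:M;
  acs_invariant : forall i j xi x u, dom i x -> dom j (tact xi x) ->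
    let T := fun y => cmap j (tact xi (cinv i y)) in
    'D_(u *m J i (cmap i x)) T (cmap i x) =
      'D_u T (cmap i x) *m J j (cmap j (tact xi x));
  acs_symmetric : forall i y u v, img i y ->
    bform (omega i y) (u *m J i y) v = bform (omega i y) (v *m J i y) u;
  acs_positive : forall i y u, img i y -> u != 0 ->
    0 < bform (omega i y) (u *m J i y) u }.

Definition fixedpt (R : realType) n (X : symplectic_toric_manifold R n) :
  set (mspace X) := [set x | forall xi, tact xi x = x].
Arguments fixedpt {R n} X _.

(* w such that, for some v <> 0 in (T_p M, J), exp xi acts on v as the complex
   number exp (2 i pi w(xi)). *)
Definition weights (R : realType) n (X : symplectic_toric_manifold R n)
    (J : acs_field X) (p : mspace X) : set 'rV[int]_n :=
  [set w | exists (i : chart (charts X)) (v : 'rV[R]_n.*2),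
    [/\ dom i p, v != 0 & forall xi : 'rV[R]_n,
      'D_v (fun y => cmap i (tact xi (cinv i y))) (cmap i p) =
        cos (2 * pi * wdot w xi) *: v +
        sin (2 * pi * wdot w xi) *: (v *m J i (cmap i p))]].

Definition pos_weights (R : realType) n (X : symplectic_toric_manifold R n)
    (J : acs_field X) (xib : 'rV[R]_n) (p : mspace X) : set 'rV[int]_n :=
  [set w | weights J p w /\ 0 < wdot w xib].

Definition neg_weights (R : realType) n (X : symplectic_toric_manifold R n)
    (J : acs_field X) (xib : 'rV[R]_n) (p : mspace X) : set 'rV[int]_n :=
  [set w | weights J p w /\ wdot w xib < 0].

Definition lambda (R : realType) n (X : symplectic_toric_manifold R n)
    (J : acs_field X) (xib : 'rV[R]_n) (p : mspace X) : nat :=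
  #|` fset_set (pos_weights J xib p)|%fset.

Definition mu (R : realType) n (X : symplectic_toric_manifold R n)
  (xib : 'rV[R]_n) (x : mspace X) : R := dot (psi x) xib.

Definition generic (R : realType) n (X : symplectic_toric_manifold R n)
    (J : acs_field X) (xib : 'rV[R]_n) : Prop :=
  (forall p w, fixedpt X p -> weights J p w -> wdot w xib != 0) /\
  (forall p q, fixedpt X p -> fixedpt X q -> mu xib p = mu xib q -> p = q).

Definition seg (R : realType) n (a b : 'rV[R]_n) : set 'rV[R]_n :=
  [set x | exists t : R, 0 <= t <= 1 /\ x = (1 - t) *: a + t *: b].

(* F is a face of the convex set P. *)
Definition is_face (R : realType) n (P F : set 'rV[R]_n) : Prop :=
  F `<=` P /\
  forall x y (t : R), P x -> P y -> 0 < t < 1 ->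
    F ((1 - t) *: x + t *: y) -> F x /\ F y.

Definition edge (R : realType) n (X : symplectic_toric_manifold R n)
    (r q : mspace X) : Prop :=
  [/\ fixedpt X r, fixedpt X q, psi r <> psi q &
      is_face (range (@psi _ _ X)) (seg (psi r) (psi q))].

Definition primitive_weight n (w : 'rV[int]_n) : Prop :=
  forall (k : int) (v : 'rV[int]_n), w = k *: v -> `|k| = 1.

(* The primitive element w of l* with psi q - psi r = m w, m > 0; it is unique,
   and 0 is only a default value. *)
Definition edge_weight (R : realType) n (X : symplectic_toric_manifold R n)
    (r q : mspace X) : 'rV[int]_n :=
  xget 0 [set w | primitive_weight w /\
    exists m : R, 0 < m /\ psi q - psi r = m *: intv R w].

Definition index_increasing (R : realType) n
    (X : symplectic_toric_manifold R n) (J : acs_field X) (xib : 'rV[R]_n) :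
    Prop :=
  forall r q : mspace X, edge r q -> mu xib r < mu xib q ->
    (lambda J xib r < lambda J xib q)%N.

(* Background on symplectic toric manifolds: the convexity theorem of Atiyah
   and Guillemin-Sternberg and Delzant's description of psi(M) near its
   vertices. *)
Record toric_background (R : realType) n (X : symplectic_toric_manifold R n)
    (J : acs_field X) : Prop := ToricBackground {
  fixedpt_finite : finite_set (fixedpt X);
  psi_convex_hull : range (@psi _ _ X) =
    [set a | exists c : mspace X -> R,
      [/\ forall p, 0 <= c p,
          \sum_(p \in fixedpt X) c p = 1 &
          a = \sum_(p \in fixedpt X) (c p *: psi p)]];
  psi_fixedpt_inj : forall p q, fixedpt X p -> fixedpt X q ->
    psi p = psi q -> p = q;
  psi_fixedpt_vertex : forall p, fixedpt X p ->
    is_face (range (@psi _ _ X)) [set psi p];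
  weights_basis : forall p, fixedpt X p ->
    exists B : 'M[int]_n, B \in unitmx /\
      weights J p = range (fun k => row k B);
  weights_edges : forall q, fixedpt X q ->
    weights J q = [set edge_weight r q | r in [set r | edge r q]] }.

Definition flow_up (R : realType) n (X : symplectic_toric_manifold R n)
    (J : acs_field X) (xib : 'rV[R]_n) (p : mspace X) : set (mspace X) :=
  [set x | exists c : 'rV[int]_n -> R,
    psi x = psi p + \sum_(w \in neg_weights J xib p) (c w *: intv R w)].

(* T-equivariant complex vector bundles, by local trivializations
   tcoord a : proj^-1 (tdom a) -> C^rank. As M is connected the rank is
   constant. *)
Record equivariant_bundle (R : realType) n
    (X : symplectic_toric_manifold R n) := EquivariantBundle {
  brank : nat;
  btotal : topologicalType;
  proj : btotal -> mspace X;
  triv : Type;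
  tdom : triv -> set (mspace X);
  tcoord : triv -> btotal -> 'rV[Cx R]_brank;
  tinv : triv -> mspace X -> 'rV[Cx R]_brank -> btotal;
  bact : 'rV[R]_n -> btotal -> btotal;
  proj_continuous : continuous proj;
  tdom_open : forall a, open (tdom a);
  tdom_cover : forall x, exists a, tdom a x;
  tcoordK : forall a e, tdom a (proj e) -> tinv a (proj e) (tcoord a e) = e;
  proj_tinv : forall a x v, tdom a x -> proj (tinv a x v) = x;
  tinvK : forall a x v, tdom a x -> tcoord a (tinv a x v) = v;
  tcoord_continuous : forall a e, tdom a (proj e) ->
    {for e, continuous (tcoord a)};
  tinv_continuous : forall a x v, tdom a x ->
    {for (x, v), continuous (fun z => tinv a z.1 z.2)};
  transition_linear : forall a b x, tdom a x -> tdom b x ->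
    exists g : 'M[Cx R]_brank, forall v, tcoord b (tinv a x v) = v *m g;
  bact_add : forall xi zeta e, bact (xi + zeta) e = bact xi (bact zeta e);
  bact_int : forall (w : 'rV[int]_n) e, bact (intv R w) e = e;
  bact_continuous : continuous (fun z : 'rV[R]_n * btotal => bact z.1 z.2);
  bact_proj : forall xi e, proj (bact xi e) = tact xi (proj e);
  bact_linear : forall a b xi x, tdom a x -> tdom b (tact xi x) ->
    exists g : 'M[Cx R]_brank,
      forall v, tcoord b (bact xi (tinv a x v)) = v *m g }.

(* Character of the representation of T on the fibre at a fixed point p, computed
   in a trivialization a around p. *)
Definition fibre_char (R : realType) n (X : symplectic_toric_manifold R n)
    (E : equivariant_bundle X) (a : triv E) (p : mspace X) (xi : 'rV[R]_n) :
    Cx R :=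
  \tr (lin1_mx (fun v => tcoord a (bact xi (tinv a p v)))).

(* Elements of R(T) are identified with their characters, as functions on t. A
   class is given by its restrictions to the fixed points; its values elsewhere
   are irrelevant. *)
Definition kclass (R : realType) n (X : symplectic_toric_manifold R n) :=
  mspace X -> 'rV[R]_n -> Cx R.

(* tau is the family of restrictions of [E] - [F] for some T-bundles E and F. *)
Definition in_KT (R : realType) n (X : symplectic_toric_manifold R n)
    (tau : kclass X) : Prop :=
  exists E F : equivariant_bundle X, forall p (a : triv E) (b : triv F) xi,
    fixedpt X p -> tdom a p -> tdom b p ->
    tau p xi = fibre_char a p xi - fibre_char b p xi.

Definition is_poincare_dual (R : realType) n
    (X : symplectic_toric_manifold R n) (J : acs_field X) (xib : 'rV[R]_n)
    (p : mspace X) (eta : kclass X) : Prop :=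
  [/\ in_KT eta,
      forall q xi, fixedpt X q -> ~ flow_up J xib p q -> eta q xi = 0 &
      forall q xi, fixedpt X q -> flow_up J xib p q ->
        eta q xi =
          \big[*%R/1]_(r \in [set r | [/\ fixedpt X r, ~ flow_up J xib p r
                                        & edge r q]])
            (1 - chi (edge_weight r q) xi)].

Definition is_kirwan (R : realType) n (X : symplectic_toric_manifold R n)
    (J : acs_field X) (xib : 'rV[R]_n) (p : mspace X) (nu : kclass X) : Prop :=
  [/\ in_KT nu,
      forall xi,
        nu p xi = \big[*%R/1]_(w \in pos_weights J xib p) (1 - chi w xi) &
      forall q xi, fixedpt X q -> mu xib q < mu xib p -> nu q xi = 0].

(* Formal Laurent polynomials in m variables with integer coefficients: finite
   sums of terms (coefficient, exponents). *)
Definition laurent (m : nat) := seq (int * 'rV[int]_m).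

Definition leval (R : realType) m (f : laurent m) (u : 'I_m -> Cx R) : Cx R :=
  \sum_(t <- f) t.1%:~R * \prod_(i < m) u i ^ t.2 0 i.

(* In the next four definitions l is the number of positive weights,
   s k = w_k(xi) and s0 = w_0(xi'), for (xi', xi) in the Lie algebra of
   S^1 * T; the index k : 'I_n stands for w_(k+1). *)
Definition loc0 (R : realType) n (l : nat) (f : laurent n) (s0 : R)
    (s : 'I_n -> R) : Cx R :=
  leval f (fun k => if (k < l)%N then expi (s0 + s k) else expi (s k)).

Definition locj (R : realType) n (l : nat) (f : laurent n)
    (s : 'I_n -> R) (j : 'I_n) : Cx R :=
  leval f (fun k => if (k < l)%N then expi (s k - s j) else expi (s k)).

Definition den0 (R : realType) n (l : nat) (s0 : R) (s : 'I_n -> R) : Cx R :=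
  \prod_(k < n | (k < l)%N) (1 - expi (s k + s0)).

Definition denj (R : realType) n (l : nat) (s0 : R) (s : 'I_n -> R)
    (j : 'I_n) : Cx R :=
  (1 - expi (- (s j + s0))) *
  \prod_(k < n | (k < l)%N && (k != j)) (1 - expi (s k - s j)).

(* g = Ind_q(tau). The pushforward to a point is the Laurent polynomial h in the
   exponentials of w_0, w_1, ..., w_n that equals the localization sum as a
   rational function, i.e. wherever the denominators do not vanish; this
   determines h. Sending w_0 to 0 replaces the exponential of w_0 by 1. *)
Definition is_local_index (R : realType) n (X : symplectic_toric_manifold R n)
    (J : acs_field X) (xib : 'rV[R]_n) (q : mspace X) (tau : kclass X)
    (g : 'rV[R]_n -> Cx R) : Prop :=
  let l := lambda J xib q in
  exists (w : 'I_n -> 'rV[int]_n) (f : laurent n) (h : laurent n.+1),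
    let s xi := fun k => wdot (w k) xi in
    let hval z xi := leval h (fun i : 'I_n.+1 =>
      oapp (fun k => chi (w k) xi) z (unlift ord0 i)) in
    [/\ injective w /\ range w = weights J q,
        forall k : 'I_n, (k < l)%N <-> pos_weights J xib q (w k),
        forall xi, tau q xi = leval f (fun k => chi (w k) xi),
        forall (s0 : R) (xi : 'rV[R]_n),
          den0 l s0 (s xi) != 0 ->
          (forall j : 'I_n, (j < l)%N -> denj l s0 (s xi) j != 0) ->
          hval (expi s0) xi =
            loc0 l f s0 (s xi) / den0 l s0 (s xi) +
            \sum_(j < n | (j < l)%N)
               locj l f (s xi) j / denj l s0 (s xi) j &
        forall xi, g xi = hval 1 xi].

Definition is_icanonical (R : realType) n (X : symplectic_toric_manifold R n)
    (J : acs_field X) (xib : 'rV[R]_n) (p : mspace X) (tau : kclass X) : Prop :=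
  [/\ is_kirwan J xib p tau,
      forall q, fixedpt X q -> flow_up J xib p q ->
        is_local_index J xib q tau (fun=> 1) &
      forall q, fixedpt X q -> ~ flow_up J xib p q ->
        is_local_index J xib q tau (fun=> 0)].

(* Main.v *)
(* Let q be a fixed point on F_p. Index increasing forces every edge at q which
   is normal to F_p to descend. Indeed lambda_q >= lambda_p + (number of
   descending edges of F_p at q): let G be the face of F_p spanned at q by these
   edges, and r the second highest vertex of G; all edges of G at r descend
   except one, and that one leads to q, so the claim for r gives the claim for q.
   As F_p has lambda_p normal edges at each vertex, equality must hold. Hence
   eta_p(q) = prod_(k in N) (1 - e^(2 i pi w_k)) with N among the positive
   weights, and in the localization sum over CP^l the factors of N either cancel
   or vanish, which leaves the pushforward of 1 from CP^(l - |N|). This is 1 by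
   Lagrange interpolation. *)
Require Import Defs.
From HB Require Import structures.
From mathcomp Require Import all_boot all_order all_algebra.
From mathcomp Require Import all_classical all_reals all_analysis.
From mathcomp Require Import finmap.
From mathcomp.real_closed Require Import complex.
From mathcomp Require Import fintype finset.
Set Implicit Arguments.
Unset Strict Implicit.
Unset Printing Implicit Defensive.
Import Order.TTheory GRing.Theory Num.Theory.
Local Open Scope ring_scope.

(** * Simple polytopes *)

Definition lin (R : nzRingType) n (phi : 'cV[R]_n) (x : 'rV[R]_n) : R :=
  (x *m phi) 0 0.

Lemma linB (R : nzRingType) n (phi : 'cV[R]_n) x y :
  lin phi (x - y) = lin phi x - lin phi y.
Proof. by rewrite /lin mulmxBl !mxE. Qed.

Lemma lin_sum (R : nzRingType) n (phi : 'cV[R]_n) I (r : seq I) P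
    (c : I -> R) (x : I -> 'rV[R]_n) :
  lin phi (\sum_(i <- r | P i) c i *: x i) =
  \sum_(i <- r | P i) c i * lin phi (x i).
Proof.
rewrite /lin mulmx_suml summxE; apply: eq_bigr => i _.
by rewrite -scalemxAl mxE.
Qed.

Definition edge_mx (R : nzRingType) n (V : Type) (vtx : V -> 'rV[R]_n)
  (nb : V -> 'I_n -> V) (q : V) : 'M[R]_n :=
  \matrix_k (vtx q - vtx (nb q k)).

(** Both differences start from [vtx q], so these are also the coordinates of [vtx s - vtx q] along
    the edge vectors leaving [q]. *)
Definition coord (R : comUnitRingType) n (V : Type) (vtx : V -> 'rV[R]_n)
  (nb : V -> 'I_n -> V) (q s : V) : 'rV[R]_n :=
  (vtx q - vtx s) *m invmx (edge_mx vtx nb q).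

(* nb q k is the k-th neighbour of q. By coord_ge0 the polytope lies in the
   simplicial cone spanned at each vertex by the edges. *)
Record simple_polytope (R : realFieldType) n (V : finType)
    (vtx : V -> 'rV[R]_n) (nb : V -> 'I_n -> V) : Prop := SimplePolytope {
  edge_mx_unit : forall q, edge_mx vtx nb q \in unitmx;
  coord_ge0 : forall q s k, 0 <= coord vtx nb q s 0 k;
  nb_sym : forall q k, exists j, nb (nb q k) j = q }.

Section SimplePolytope.
Variables (R : realFieldType) (n : nat) (V : finType).
Variables (vtx : V -> 'rV[R]_n) (nb : V -> 'I_n -> V).
Hypothesis P : simple_polytope vtx nb.
Implicit Types (p q r s : V) (k : 'I_n) (phi xi : 'cV[R]_n) (K : {set 'I_n}).
Local Notation E := (edge_mx vtx nb).
Local Notation co := (coord vtx nb).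

Lemma coordE q s :
  vtx q - vtx s = \sum_k co q s 0 k *: (vtx q - vtx (nb q k)).
Proof.
rewrite -[LHS](mulmxKV (edge_mx_unit P q)) -/(co q s) mulmx_sum_row.
by apply: eq_bigr => k _; rewrite rowK.
Qed.

Lemma lin_coord phi q s :
  lin phi (vtx q) - lin phi (vtx s) =
  \sum_k co q s 0 k * (lin phi (vtx q) - lin phi (vtx (nb q k))).
Proof.
rewrite -linB coordE lin_sum; apply: eq_bigr => k _.
by rewrite linB.
Qed.

Lemma coord_nb q k j : co q (nb q k) 0 j = (k == j)%:R.
Proof.
rewrite /coord -[vtx q - _](rowK (fun k => vtx q - vtx (nb q k)) k).
by rewrite -/(E q) -row_mul mulmxV ?(edge_mx_unit P) // row1 mxE eqxx eq_sym.
Qed.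

Lemma coord_uniq q s (a : 'I_n -> R) k :
  vtx q - vtx s = \sum_j a j *: (vtx q - vtx (nb q j)) -> co q s 0 k = a k.
Proof.
rewrite /coord => ->; rewrite mulmx_suml summxE (bigD1 k) //=.
rewrite big1 => [|j /negPf jk]; rewrite -scalemxAl mxE.
all: have -> (i : 'I_n) : ((vtx q - vtx (nb q i)) *m invmx (E q)) 0 k =
  co q (nb q i) 0 k by [].
all: by rewrite coord_nb ?eqxx ?jk ?mulr1 ?addr0 ?mulr0.
Qed.

Lemma coordxx q : co q q = 0.
Proof. by rewrite /coord subrr mul0mx. Qed.

Lemma nb_inj q : injective (nb q).
Proof.
move=> k j /(congr1 (fun s => co q s 0 j)); rewrite !coord_nb eqxx.
by case: eqP => // _ /eqP; rewrite eq_sym oner_eq0.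
Qed.

(* Faces are represented by the functionals that are minimal on them. *)
Definition face_of phi s :=
  [forall t, lin phi (vtx s) <= lin phi (vtx t)].

Definition face_dirs phi q : {set 'I_n} := [set k | face_of phi (nb q k)].

Lemma face_ofE phi q s : face_of phi q ->
  face_of phi s = (lin phi (vtx s) == lin phi (vtx q)).
Proof.
move=> /forallP Fq; apply/idP/idP => [/forallP Fs|/eqP eqs].
  by rewrite eq_le Fs Fq.
by apply/forallP=> t; rewrite eqs Fq.
Qed.

(** Since [phi] agrees at [q] and [s], expanding its difference along the edges gives a vanishing
    sum of terms of one sign, so each term vanishes. *)
Lemma face_coord phi q s k :
  face_of phi q -> face_of phi s -> co q s 0 k != 0 -> k \in face_dirs phi q.
Proof.
move=> Fq Fs nz; rewrite inE (face_ofE _ Fq).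
have := lin_coord phi q s; move: Fs; rewrite (face_ofE _ Fq) => /eqP ->.
rewrite subrr => /esym /eqP; rewrite -oppr_eq0 -sumrN psumr_eq0 => [|j _].
  move=> /allP /(_ k (mem_index_enum _)) /=.
  by rewrite -mulrN mulf_eq0 (negPf nz) opprB subr_eq0.
rewrite -mulrN mulr_ge0 ?(coord_ge0 P) // opprB subr_ge0.
exact: (forallP Fq).
Qed.

(** The edge vectors of a face at a vertex are independent, and by [face_coord] they span all
    differences within the face, so ranks can be compared. *)
Lemma le_card_face_dirs phi q r : face_of phi q -> face_of phi r ->
  (#|face_dirs phi r| <= #|face_dirs phi q|)%N.
Proof.
move=> Fq Fr.
pose S s : 'M[R]_(#|face_dirs phi s|, n) := rowsub enum_val (E s).
have rkS s : \rank (S s) = #|face_dirs phi s|.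
  apply/eqP; rewrite -[_ == _]/(row_free _).
  have SE : S s = rowsub enum_val 1%:M *m E s.
    by rewrite mul_rowsub_mx mul1mx.
  apply/row_freeP; exists (invmx (E s) *m (rowsub enum_val 1%:M)^T).
  rewrite SE -mulmxA (mulmxA (E s)) mulmxV ?(edge_mx_unit P) // mul1mx.
  apply/matrixP => i j; rewrite mxE (bigD1 (enum_val i)) //= big1 => [|k ki].
    by rewrite !mxE eqxx mul1r addr0 (inj_eq enum_val_inj) eq_sym.
  by rewrite !mxE eq_sym (negPf ki) mul0r.
have subS s : face_of phi s -> (vtx q - vtx s <= S q)%MS.
  move=> Fs; rewrite coordE; apply: summx_sub => k _.
  have [->|nz] := eqVneq (co q s 0 k) 0; first by rewrite scale0r sub0mx.
  have kF := face_coord Fq Fs nz.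
  apply: scalemx_sub; have -> : vtx q - vtx (nb q k) = row (enum_rank_in kF k) (S q).
    by rewrite row_rowsub enum_rankK_in // rowK.
  exact: row_sub.
rewrite -rkS -(rkS q); apply: mxrankS; apply/row_subP => i.
rewrite row_rowsub rowK.
have -> : vtx r - vtx (nb r (enum_val i)) =
    (vtx q - vtx (nb r (enum_val i))) - (vtx q - vtx r).
  by rewrite opprB [RHS]addrC addrA subrK.
apply: addmx_sub; last by rewrite eqmx_opp; exact: subS.
by apply: subS; have := enum_valP i; rewrite inE.
Qed.

Lemma card_face_dirs phi q r : face_of phi q -> face_of phi r ->
  #|face_dirs phi r| = #|face_dirs phi q|.
Proof. by move=> Fq Fr; apply/eqP; rewrite eqn_leq !le_card_face_dirs. Qed.

(* The face at q spanned by the edges in K is where this functional, which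
   sums the coordinates at q outside K, is minimal. *)
Definition span_fun q K : 'cV[R]_n :=
  - (invmx (E q) *m \col_k (k \notin K)%:R).

Lemma lin_span_fun q K s :
  lin (span_fun q K) (vtx s) =
  lin (span_fun q K) (vtx q) + \sum_(k | k \notin K) co q s 0 k.
Proof.
apply/eqP; rewrite addrC -subr_eq -linB /lin mulmxN -mulNmx opprB mulmxA.
rewrite mxE; apply/eqP; rewrite [RHS]big_mkcond; apply: eq_bigr => k _; rewrite !mxE.
by case: ifP; rewrite (mulr1, mulr0).
Qed.

Lemma span_fun_self q K : face_of (span_fun q K) q.
Proof.
apply/forallP => t; rewrite [leRHS]lin_span_fun lerDl sumr_ge0 // => k _.
exact: coord_ge0.
Qed.

Lemma span_funP q K s :
  reflect (forall k, k \notin K -> co q s 0 k = 0) (face_of (span_fun q K) s).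
Proof.
rewrite (face_ofE _ (span_fun_self q K)) lin_span_fun -subr_eq0 addrC addKr.
rewrite psumr_eq0 => [|k _]; last exact: coord_ge0.
apply: (iffP allP) => [h k kK|h k _]; last by apply/implyP => /h ->.
by apply/eqP; move: (h k (mem_index_enum _)) => /implyP; apply.
Qed.

Lemma span_fun_dirs q K : face_dirs (span_fun q K) q = K.
Proof.
apply/setP => k; rewrite inE; apply/span_funP/idP => [h|kK j jK].
  apply: contraT => /h; rewrite coord_nb eqxx => /eqP.
  by rewrite oner_eq0.
by rewrite coord_nb; case: eqP jK => // <-; rewrite kK.
Qed.

(** * Descending edges and the index inequality *)

Definition down xi q : {set 'I_n} :=
  [set k | lin xi (vtx (nb q k)) < lin xi (vtx q)].

(** A local minimum is global: the displacement from [q] to [s] is a nonnegative combination of face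
    edges at [q], none of which descends. *)
Lemma face_min xi phi q s : face_of phi q -> face_of phi s ->
  face_dirs phi q :&: down xi q = set0 -> lin xi (vtx q) <= lin xi (vtx s).
Proof.
move=> Fq Fs K0; rewrite -subr_le0 lin_coord sumr_le0 // => k _.
have [->|nz] := eqVneq (co q s 0 k) 0; first by rewrite mul0r.
rewrite mulr_ge0_le0 ?(coord_ge0 P) // subr_le0 leNgt; apply/negP => lt.
have := in_set0 k; rewrite -K0 in_setI (face_coord Fq Fs nz) /=.
by rewrite inE lt.
Qed.

Lemma face_max xi phi q s : face_of phi q -> face_of phi s ->
  face_dirs phi q \subset down xi q -> lin xi (vtx s) <= lin xi (vtx q).
Proof.
move=> Fq Fs /subsetP K0; rewrite -subr_ge0 lin_coord sumr_ge0 // => k _.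
have [->|nz] := eqVneq (co q s 0 k) 0; first by rewrite mul0r.
rewrite mulr_ge0 ?(coord_ge0 P) // subr_ge0 ltW //.
by have := K0 _ (face_coord Fq Fs nz); rewrite inE.
Qed.

(* The second highest vertex r of the face G spanned at q by the descending
   edges of F: all edges of G at r descend, except the one leading to q. *)
Lemma down_nb xi phi q : injective (fun s => lin xi (vtx s)) ->
  face_of phi q -> face_dirs phi q :&: down xi q != set0 ->
  exists k, [/\ k \in face_dirs phi q :&: down xi q &
   (#|face_dirs phi q :&: down xi q| <=
    #|face_dirs phi (nb q k) :&: down xi (nb q k)|.+1)%N].
Proof.
move=> inj_xi Fq; set K := _ :&: _ => /set0Pn[k0 k0K].
pose G := face_of (span_fun q K).
have Gq : G q by exact: span_fun_self.
have GF s : G s -> face_of phi s.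
  move=> /span_funP Gs; rewrite (face_ofE _ Fq) eq_sym -subr_eq0 lin_coord.
  rewrite big1 // => k _; have [kK|/Gs ->] := boolP (k \in K); last first.
    by rewrite mul0r.
  move: kK; rewrite inE => /andP[]; rewrite inE (face_ofE _ Fq) => /eqP -> _.
  by rewrite subrr mulr0.
have Gmax s : G s -> s != q -> lin xi (vtx s) < lin xi (vtx q).
  move=> Gs sq; rewrite lt_neqAle (inj_eq inj_xi) sq /=.
  by apply: (face_max Gq Gs); rewrite span_fun_dirs subsetIr.
pose G' s := G s && (s != q).
have Gk0 : G' (nb q k0).
  have := k0K; rewrite -{1}(span_fun_dirs q K) inE /G' => Gk; apply/andP; split=> //.
  move: k0K; rewrite inE => /andP[_]; rewrite inE.
  by apply: contraTneq => ->; rewrite ltxx.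
have [r /andP[Gr rq] rmax] := @arg_maxP _ _ _ _ G' (fun s => lin xi (vtx s)) Gk0.
(* [r] is the highest vertex of [G] other than [q], so a non-descending edge of [G] at [r] can only
   end at [q]. *)
have upE j : j \in face_dirs (span_fun q K) r -> j \notin down xi r -> nb r j = q.
  move=> jF jd; apply/eqP; apply: contraNT jd => nq.
  have Gj : G (nb r j) by move: jF; rewrite inE.
  rewrite inE lt_neqAle (inj_eq inj_xi) [_ <= _]rmax ?andbT /G' ?Gj //.
  apply/eqP => nr; have := coord_nb r j j; rewrite nr coordxx mxE eqxx.
  by move/eqP; rewrite eq_sym oner_eq0.
set L := face_dirs (span_fun q K) r in upE.
have cardL : #|L| = #|K| by rewrite /L (card_face_dirs Gq Gr) span_fun_dirs.
(* If all edges of [G] at [r] descended, [r] would be a maximum of [G], but [q] is higher. *)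
have [j jL jd] : exists2 j, j \in L & j \notin down xi r.
  have : ~~ (L \subset down xi r).
    apply/negP => sub; have := face_max Gr Gq sub.
    by rewrite leNgt Gmax.
  by move=> /subsetPn[j jL jd]; exists j.
have nbj := upE j jL jd.
have [k nbk] := nb_sym P r j; rewrite nbj in nbk.
exists k; rewrite nbk; split.
  by rewrite -(span_fun_dirs q K) inE nbk.
rewrite -cardL (cardsD1 j) jL add1n ltnS subset_leq_card //.
apply/subsetP => i; rewrite !inE => /andP[ij iL].
rewrite (GF _ iL) /=; apply: contraNT ij => id.
apply/eqP; apply: (@nb_inj r); rewrite nbj upE ?inE //.
Qed.

(** Induction on the number of vertices below [q]. Without descending face edges [q] is the minimum
    of the face, that is [p]. Otherwise, at the neighbour from [down_nb], the number of descending
    face edges drops by at most one and the index by at least one. *)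
Lemma index_face xi phi p q : injective (fun s => lin xi (vtx s)) ->
  (forall s k, k \in down xi s -> (#|down xi (nb s k)| < #|down xi s|)%N) ->
  face_of phi p -> face_dirs phi p :&: down xi p = set0 -> face_of phi q ->
  (#|down xi p| + #|face_dirs phi q :&: down xi q| <= #|down xi q|)%N.
Proof.
move=> inj_xi incr Fp p0.
have [m] := ubnP #|[set s | lin xi (vtx s) < lin xi (vtx q)]|.
elim: m => // m IH in q * => ltm Fq.
have [q0|qn0] := eqVneq (face_dirs phi q :&: down xi q) set0.
  suff -> : p = q by rewrite q0 cards0 addn0.
  apply: inj_xi; apply: le_anti; rewrite (face_min Fp Fq p0) //=.
  exact: face_min Fq Fp q0.
have [k [kK cardK]] := down_nb inj_xi Fq qn0.
move: kK; rewrite inE => /andP[kF kd].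
have Fk : face_of phi (nb q k) by move: kF; rewrite inE.
apply: leq_trans (incr _ _ kd).
apply: leq_trans (leq_add (leqnn _) cardK) _.
rewrite addnS ltnS IH // -ltnS; apply: leq_trans ltm; rewrite ltnS.
have kd' := kd; rewrite inE in kd'.
apply: proper_card; apply/properP; split.
  by apply/subsetP => s; rewrite !inE => /lt_trans; apply.
by exists (nb q k); rewrite !inE ?ltxx.
Qed.

(** At [q], as at [p], exactly [#|down xi p|] edges are normal to the face, and by [index_face] at
    least that many normal edges at [q] descend. *)
Lemma normal_dirs_down xi phi p q : injective (fun s => lin xi (vtx s)) ->
  (forall s k, k \in down xi s -> (#|down xi (nb s k)| < #|down xi s|)%N) ->
  face_of phi p -> face_dirs phi p = ~: down xi p -> face_of phi q ->
  ~: face_dirs phi q \subset down xi q.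
Proof.
move=> inj_xi incr Fp pE Fq.
have := index_face inj_xi incr Fp _ Fq; rewrite {1}pE setIC setICr => /(_ erefl).
rewrite -(cardsID (face_dirs phi q) (down xi q)) setIC addnC leq_add2l => le.
have le2 : (#|~: face_dirs phi q| <= #|down xi q :\: face_dirs phi q|)%N.
  apply: leq_trans le; rewrite -(leq_add2l #|face_dirs phi q|) cardsC.
  by rewrite (card_face_dirs Fp Fq) pE addnC cardsC.
rewrite setDE in le2.
have /eqP <- : down xi q :&: ~: face_dirs phi q == ~: face_dirs phi q.
  by rewrite eqEcard subsetIr le2.
exact: subsetIl.
Qed.
End SimplePolytope.

(** * Vertex cones of polytopes *)

Definition hull (R : realType) n (V : finType) (vtx : V -> 'rV[R]_n) :
    set 'rV[R]_n :=
  [set x | exists c : V -> R,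
    [/\ forall s, 0 <= c s, \sum_s c s = 1 & x = \sum_s c s *: vtx s]]%classic.

Section VertexCone.
Variables (R : realType) (n : nat) (V : finType) (vtx : V -> 'rV[R]_n).
Variable p : V.
Hypothesis face_p : is_face (hull vtx) [set vtx p]%classic.
Implicit Types (r s : V) (c : V -> R) (S : {set V}).
Let d s := vtx s - vtx p.

Lemma sum_disp c :
  \sum_s c s *: d s = \sum_s c s *: vtx s - (\sum_s c s) *: vtx p.
Proof.
rewrite scaler_suml -sumrB; apply: eq_bigr => s _; exact: scalerBr.
Qed.

Lemma hull_disp c : (forall s, 0 <= c s) -> \sum_s c s <= 1 ->
  hull vtx (vtx p + \sum_s c s *: d s).
Proof.
(* The weight missing from the total 1 is put on [p], whose displacement is zero. *)
move=> c0 c1; exists (fun s => c s + (if s == p then 1 - \sum_s c s else 0)).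
split=> [s||].
- by rewrite addr_ge0 //; case: ifP => // _; rewrite subr_ge0.
- by rewrite big_split /= -big_mkcond big_pred1_eq addrC subrK.
rewrite [RHS](eq_bigr _ (fun s _ => scalerDl (vtx s) (c s) _)).
rewrite big_split /= [X in _ = _ + X](bigD1 p) //= eqxx.
rewrite [X in _ = _ + (_ + X)]big1 => [|s /negPf ->].
  by rewrite sum_disp addr0 scalerBl scale1r addrCA.
exact: scale0r.
Qed.

Lemma hullP x : hull vtx x -> exists c,
  [/\ forall s, 0 <= c s, \sum_s c s = 1 & x - vtx p = \sum_s c s *: d s].
Proof.
move=> [c [c0 c1 ->]]; exists c; split=> //.
by rewrite sum_disp c1 scale1r.
Qed.

(** If the displacements cancel, one term is opposite to the sum of the others. Scaled down by [T],
    the two give points of the hull with midpoint [vtx p], and extremality of the vertex forces both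
    to be [vtx p]. *)
Lemma vertex_pointed c : (forall s, 0 <= c s) -> \sum_s c s *: d s = 0 ->
  forall s, c s *: d s = 0.
Proof.
move=> c0 cd s; have [->|cs] := eqVneq (c s) 0; first exact: scale0r.
have cs0 : 0 < c s by rewrite lt_neqAle eq_sym cs c0.
set T := \sum_s c s; have leT s' : c s' <= T.
  by rewrite /T (bigD1 s') //= lerDl sumr_ge0.
have T0 : 0 < T by apply: lt_le_trans (leT s).
have hs (e : V -> R) : (forall s, 0 <= e s <= c s) ->
    hull vtx (vtx p + T^-1 *: \sum_s e s *: d s).
  move=> he; rewrite scaler_sumr; under eq_bigr do rewrite scalerA.
  apply: hull_disp => [s'|].
    by rewrite mulr_ge0 ?invr_ge0 ?(ltW T0) //; case/andP: (he s').
  rewrite -mulr_sumr ler_pdivrMl // mulr1; apply: ler_sum => s' _.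
  by case/andP: (he s').
pose e1 s' := if s' == s then c s else 0.
pose e2 s' := if s' == s then 0 else c s'.
have h1 : hull vtx (vtx p + T^-1 *: \sum_s e1 s *: d s).
  by apply: hs => s'; rewrite /e1; case: eqP => [->|_]; rewrite ?c0 ?lexx.
have h2 : hull vtx (vtx p + T^-1 *: \sum_s e2 s *: d s).
  by apply: hs => s'; rewrite /e2; case: eqP => [->|_]; rewrite ?c0 ?lexx.
have e12 : \sum_s e1 s *: d s = - \sum_s e2 s *: d s.
  apply/eqP; rewrite -addr_eq0 -big_split /= -[X in _ == X]cd; apply/eqP.
  apply: eq_bigr => s' _; rewrite -scalerDl /e1 /e2.
  by case: eqP => [->|_]; rewrite (addr0, add0r).
have e1E : \sum_s e1 s *: d s = c s *: d s.
  rewrite (bigD1 s) //= /e1 eqxx big1 ?addr0 // => s' /negPf ->.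
  exact: scale0r.
have half : 0 < (2^-1 : R) < 1.
  by rewrite invr_gt0 ltr0n invf_lt1 ?ltr0n // ltr1n.
have mid : [set vtx p]%classic ((1 - 2^-1) *: (vtx p + T^-1 *: \sum_s e1 s *: d s)
   + 2^-1 *: (vtx p + T^-1 *: \sum_s e2 s *: d s)).
  have halves : 2^-1 + 2^-1 = 1 :> R by rewrite [RHS](splitr 1) mul1r.
  have -> : 1 - 2^-1 = 2^-1 :> R by apply/eqP; rewrite subr_eq halves.
  rewrite -scalerDr e12 scalerN addrACA addNr addr0 scalerDr -scalerDl halves.
  exact: scale1r.
have [/= E1 _] := face_p.2 _ _ _ h1 h2 half mid.
rewrite -e1E; apply/eqP; move/eqP: E1.
rewrite -subr_eq0 addrAC subrr add0r scaler_eq0 invr_eq0.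
by rewrite (gt_eqF T0).
Qed.

(** * Extreme rays of the vertex cone *)

Definition gen S (x : 'rV[R]_n) := exists c,
  (forall s, 0 <= c s) /\ x = \sum_(s in S) c s *: d s.

Definition generates S := `[< forall s, gen S (d s) >].

(** Otherwise the expression of [d r] by the other generators could be substituted everywhere and
    [r] removed from [S]. *)
Lemma minset_gen S r : minset generates S -> r \in S -> ~ gen (S :\ r) (d r).
Proof.
move=> /minsetP[/asboolP gS minS] rS [b [b0 bE]].
suff /minS /(_ (subD1set _ _)) /setP/(_ r) : generates (S :\ r).
  by rewrite !inE eqxx rS.
apply/asboolP => s; have [a [a0 aE]] := gS s.
exists (fun s => a r * b s + a s); split=> [s'|].
  by rewrite addr_ge0 // mulr_ge0.
rewrite aE (big_setD1 r) //= {1}bE scaler_sumr -big_split /=.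
by apply: eq_bigr => s' _; rewrite scalerA scalerDl.
Qed.

(** Collect the multiples of [d r] on the right. If the coefficient is positive, [d r] is generated
    by the other rays, against minimality. Otherwise a nonnegative combination vanishes, and
    [vertex_pointed] kills every term of [x] except the one at [r]. *)
Lemma minset_extreme S r x y t : minset generates S -> r \in S ->
  gen S x -> gen S y -> x + y = t *: d r -> exists2 a, 0 <= a & x = a *: d r.
Proof.
move=> mS rS [a [a0 ->]] [b [b0 ->]]; rewrite -big_split /= => xy.
have : \sum_(s in S :\ r) (a s + b s) *: d s = (t - (a r + b r)) *: d r.
  apply/eqP; rewrite scalerBl -xy [X in _ == X - _](big_setD1 r) //=.
  rewrite -scalerDl [X in _ == X]addrC addKr.
  by apply/eqP; apply: eq_bigr => s _; rewrite scalerDl.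
have [u_le0|u_gt0] := lerP (t - (a r + b r)) 0; last first.
  move=> drE; case: (minset_gen mS rS).
  exists (fun s => (t - (a r + b r))^-1 * (a s + b s)); split=> [s|].
    by rewrite mulr_ge0 ?addr_ge0 ?invr_ge0 // ltW.
  under eq_bigr do rewrite -scalerA.
  by rewrite -scaler_sumr drE scalerA mulVf ?scale1r // gt_eqF.
move=> drE; exists (a r) => //; rewrite (big_setD1 r) //= big1 ?addr0 // => s sS.
pose e s' := if s' == r then - (t - (a r + b r)) else
             if s' \in S then a s' + b s' else 0.
have e0 s' : 0 <= e s'.
  by rewrite /e; case: ifP => _; [rewrite oppr_ge0|case: ifP => _ //; rewrite addr_ge0].
have : \sum_s e s *: d s = 0.
  rewrite (bigD1 r) //= {1}/e eqxx scaleNr -drE addrC.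
  apply/eqP; rewrite subr_eq0 [X in X == _]big_mkcond [X in _ == X]big_mkcond.
  apply/eqP; apply: eq_bigr => s' _; rewrite /e !inE.
  by case: eqP => //= _; case: ifP => // _; rewrite scale0r.
move=> /(vertex_pointed e0) /(_ s); rewrite /e.
move: sS; rewrite !inE => /andP[/negPf -> ->] /eqP.
rewrite scaler_eq0 paddr_eq0 // => /orP[/andP[/eqP -> _]|/eqP ->].
  by rewrite scale0r.
by rewrite scaler0.
Qed.

Lemma seg_sym (a b : 'rV[R]_n) : seg a b = seg b a.
Proof.
by apply/seteqP; split=> x [t [/andP[t0 t1] ->]]; exists (1 - t);
  rewrite subr_ge0 t1 lerBlDr lerDl t0 subKr addrC.
Qed.

(* The rays of a minimal generating set of the vertex cone are extreme, and the
   farthest vertex on an extreme ray is joined to p by an edge. *)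
Lemma far_edge S r : minset generates S -> r \in S -> exists r' t,
  [/\ 0 <= t, d r = t *: d r', vtx r' <> vtx p
    & is_face (hull vtx) (seg (vtx r') (vtx p))].
Proof.
move=> mS rS.
have dr0 : d r != 0.
  apply/eqP => dr0; case: (minset_gen mS rS); rewrite dr0.
  exists (fun=> 0); split=> //; rewrite big1 // => s _; exact: scale0r.
have [i dri] : exists i, d r 0 i != 0.
  apply/existsP; apply: contraNT dr0 => /existsPn h.
  apply/eqP/rowP => i; have := h i; rewrite negbK => /eqP ->; by rewrite mxE.
pose ratio s := d s 0 i / d r 0 i.
pose onray s := d s == ratio s *: d r.
have onrayP s a : d s = a *: d r -> onray s /\ ratio s = a.
  move=> E; have rE : ratio s = a by rewrite /ratio E mxE mulfK.
  by rewrite /onray rE E.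
have [rr r1] : onray r /\ ratio r = 1 by apply: onrayP; rewrite scale1r.
have [r' /eqP dr' r'max] := @arg_maxP _ _ _ _ onray ratio rr.
have {}r'max s : onray s -> ratio s <= ratio r' by exact: r'max.
have T1 : 1 <= ratio r' by rewrite -r1 r'max.
have T0 : 0 < ratio r' by apply: lt_le_trans T1.
have drE : d r = (ratio r')^-1 *: d r'.
  by rewrite dr' scalerA mulVf ?scale1r // gt_eqF.
exists r', (ratio r')^-1; split; [by rewrite invr_ge0 ltW|by []| |].
  move=> E; move: dr0; rewrite drE /d E subrr scaler0 eqxx //.
have gS s : gen S (d s) by case/minsetP: mS => /asboolP.
have genD x y : gen S x -> gen S y -> gen S (x + y).
  move=> [a [a0 ->]] [b [b0 ->]]; exists (fun s => a s + b s); split=> [s|].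
    exact: addr_ge0.
  by rewrite -big_split; apply: eq_bigr => s _; rewrite scalerDl.
have genZ k x : 0 <= k -> gen S x -> gen S (k *: x).
  move=> k0 [a [a0 ->]]; exists (fun s => k * a s); split=> [s|].
    exact: mulr_ge0.
  by rewrite scaler_sumr; apply: eq_bigr => s _; rewrite scalerA.
have gen_sum (P : pred V) c : (forall s, 0 <= c s) ->
    gen S (\sum_(s | P s) c s *: d s).
  move=> c0; elim/big_ind: _ => //; last by move=> s _; apply: genZ.
  by exists (fun=> 0); split=> //; rewrite big1 // => s _; rewrite scale0r.
(* By extremality every term of the convex combination for [x] lies on the ray of [d r]; as no
   vertex on it is farther than [r'], neither is [x]. *)
have key x y k : hull vtx x -> gen S y -> 0 < k ->
    (exists a, k *: (x - vtx p) + y = a *: d r) -> seg (vtx r') (vtx p) x.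
  move=> /hullP[c [c0 c1 xE]] gy k0 [a E].
  have h s : exists2 b, 0 <= b & c s *: d s = b *: d r.
    apply: (minset_extreme (y := (\sum_(s' | s' != s) c s' *: d s') + k^-1 *: y)
      (t := k^-1 * a) mS rS).
    - by apply: genZ.
    - by apply: genD; [exact: gen_sum|apply: genZ => //; rewrite invr_ge0 ltW].
    rewrite addrA -(bigD1 s (P := xpredT)) //= -xE -scalerA -E scalerDr scalerA.
    by rewrite mulVf ?scale1r // gt_eqF.
  pose b s := if c s == 0 then 0 else c s * ratio s.
  have bE s : [/\ 0 <= b s, b s <= c s * ratio r' & c s *: d s = b s *: d r].
    rewrite /b; have [->|cs] := eqVneq (c s) 0.
      by rewrite mul0r !scale0r lexx.
    have cs0 : 0 < c s by rewrite lt_neqAle eq_sym cs c0.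
    have [b' b0 b'E] := h s.
    have [ons rE] : onray s /\ ratio s = (c s)^-1 * b'.
      by apply: onrayP; rewrite -scalerA -b'E scalerA mulVf // scale1r.
    split.
    - by rewrite rE mulrA mulfV // mul1r.
    - by rewrite ler_pM2l // r'max.
    - by rewrite -scalerA -(eqP ons).
  have xd : x - vtx p = ((\sum_s b s) / ratio r') *: d r'.
    rewrite xE -scalerA -drE scaler_suml; apply: eq_bigr => s _.
    by case: (bE s).
  rewrite seg_sym; exists ((\sum_s b s) / ratio r'); split.
    rewrite divr_ge0 ?(ltW T0) ?sumr_ge0 //=; last by move=> s _; case: (bE s).
    rewrite ler_pdivrMr // -c1 mulr_suml; apply: ler_sum => s _.
    by case: (bE s).
  apply/eqP; rewrite -(subrK (vtx p) x) xd /d scalerBr scalerBl scale1r.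
  by rewrite addrC addrA addrAC.
have gen_hull x : hull vtx x -> gen S (x - vtx p).
  by move=> /hullP[c [c0 _ ->]]; apply: gen_sum.
have seg_hull : (seg (vtx r') (vtx p) `<=` hull vtx)%classic.
  rewrite seg_sym => x [t [/andP[t0 t1] ->]].
  have -> : (1 - t) *: vtx p + t *: vtx r' =
      vtx p + \sum_s (if s == r' then t else 0) *: d s.
    rewrite (bigD1 r') //= eqxx big1 => [|s /negPf ->]; last exact: scale0r.
    by rewrite addr0 scalerBr scalerBl scale1r addrA addrAC.
  apply: hull_disp => [s|]; first by case: ifP.
  by rewrite -big_mkcond big_pred1_eq.
split=> // x y t hx hy /andP[t0 t1].
rewrite seg_sym => -[u [/andP[u0 u1] uE]].
have E : (1 - t) *: (x - vtx p) + t *: (y - vtx p) = (u * ratio r') *: d r.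
  rewrite -scalerA -dr' !scalerBr addrACA -opprD -scalerDl subrK scale1r uE.
  by rewrite scalerBl scale1r addrAC [_ - vtx p]addrAC subrr add0r addrC.
split.
- rewrite seg_sym; apply: (key x (t *: (y - vtx p)) (1 - t)) => //.
  + by apply: genZ; [exact: ltW|exact: gen_hull].
  + by rewrite subr_gt0.
  + by exists (u * ratio r').
- rewrite seg_sym; apply: (key y ((1 - t) *: (x - vtx p)) t) => //.
  + by apply: genZ; [rewrite subr_ge0 ltW|exact: gen_hull].
  + by exists (u * ratio r'); rewrite addrC.
Qed.

(** By [far_edge], each member of a minimal generating set is a nonnegative multiple of an edge
    vector. *)
Lemma edges_generate (K : 'rV[R]_n -> Prop) :
  K 0 -> (forall x y, K x -> K y -> K (x + y)) ->
  (forall t x, 0 <= t -> K x -> K (t *: x)) ->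
  (forall r, vtx r <> vtx p -> is_face (hull vtx) (seg (vtx r) (vtx p)) ->
    K (vtx r - vtx p)) ->
  forall s, K (vtx s - vtx p).
Proof.
move=> K0 KD KZ Ke s.
have [S mS _] : {S | minset generates S & S \subset [set: V]%SET}.
  apply: minset_exists; apply/asboolP => s'.
  exists (fun r => (r == s')%:R); split=> [r|]; first by rewrite ler0n.
  rewrite (bigD1 s') ?inE //= eqxx scale1r big1 ?addr0 // => r /andP[_ /negPf ->].
  exact: scale0r.
have [/asboolP /(_ s)[c [c0 cE]] _] := minsetP mS.
rewrite -/(d s) cE; elim/big_ind: _ => // r rS; apply: (KZ) => //.
have [r' [t [t0 -> r'p /Ke]]] := far_edge mS rS.
by move=> /(_ r'p); apply: KZ.
Qed.
End VertexCone.

(** * The local index *)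

(* The Lagrange interpolation polynomial of the constant 1 at the nodes
   1 / y i, evaluated at 0. *)
Lemma sum_prod_inv_nodes (F : fieldType) (I : finType) (A : {set I})
    (y : I -> F) i0 : i0 \in A -> {in A, forall i, y i != 0} ->
  {in A &, injective y} ->
  \sum_(i in A) \prod_(k in A | k != i) (1 - y k / y i)^-1 = 1.
Proof.
move=> i0A y0 inj_y; pose w i := (y i)^-1.
have inj_w : {in A &, injective w}.
  by move=> i j iA jA /invr_inj; apply: inj_y.
pose L i : {poly F} := (\prod_(k in A | k != i) (w i - w k))^-1 *:
  \prod_(k in A | k != i) ('X - (w k)%:P).
have L0 i : i \in A -> (L i).[0] = \prod_(k in A | k != i) (1 - y k / y i)^-1.
  move=> iA; rewrite hornerZ horner_prod -prodfV -big_split /=.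
  apply: eq_bigr => k /andP[kA ki]; rewrite hornerXsubC sub0r.
  have wik : w i - w k != 0.
    by rewrite subr_eq0; apply: contra_neq ki => /(inj_w _ _ iA kA).
  have -> : 1 - y k / y i = (w i - w k) * - y k.
    by rewrite mulrN -mulNr opprB mulrBl mulVf ?y0 // mulrC.
  by rewrite invfM invrN.
have L1 i j : i \in A -> j \in A -> (L i).[w j] = (i == j)%:R.
  move=> iA jA; rewrite hornerZ horner_prod; have [<-|ij] := eqVneq.
    under [X in _ * X]eq_bigr do rewrite hornerXsubC.
    rewrite mulVf //; apply/prodf_neq0 => k /andP[kA ki].
    by rewrite subr_eq0; apply: contra_neq ki => /(inj_w _ _ iA kA).
  rewrite [X in _ * X](bigD1 j) /= ?jA 1?eq_sym //.
  by rewrite hornerXsubC subrr mul0r mulr0.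
have sizeL i : i \in A -> (size (L i) <= #|A|)%N.
  move=> iA; apply: leq_trans (size_scale_leq _ _) _.
  rewrite -big_enum size_prod_XsubC -cardE (cardsD1 i A) iA add1n ltnS.
  by apply: eq_leq; apply: eq_card => k; rewrite !inE andbC.
(* The difference has degree below [#|A|] and vanishes at [#|A|] distinct nodes; [i0] makes [A]
   nonempty, so the constant 1 meets the degree bound. *)
have Q0 : \sum_(i in A) L i - 1 = 0.
  apply: (@roots_geq_poly_eq0 _ _ [seq w i | i <- enum A]).
  - apply/allP => _ /mapP[j + ->]; rewrite mem_enum => jA.
    rewrite /root hornerD hornerN hornerC horner_sum (bigD1 j) //= L1 // eqxx.
    rewrite big1 ?addr0 ?subrr // => i /andP[iA /negPf ij].
    by rewrite L1 // ij.
  - rewrite map_inj_in_uniq ?enum_uniq // => i j.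
    by rewrite !mem_enum; exact: inj_w.
  rewrite size_map -cardE; apply: leq_trans (size_polyD _ _) _.
  rewrite geq_max size_polyN size_poly1 card_gt0 andbC.
  apply/andP; split; first by apply/set0Pn; exists i0.
  apply: leq_trans (size_sum _ _ _) _; apply/bigmax_leqP => i; exact: sizeL.
have := congr1 (fun Q : {poly F} => Q.[0]) Q0.
rewrite hornerD hornerN hornerC horner0 horner_sum => /eqP.
by rewrite subr_eq0 (eq_bigr _ L0) => /eqP.
Qed.

Section Exponential.
Variable R : realType.
Implicit Types a b : R.

Lemma expiD a b : expi (a + b) = expi a * expi b.
Proof.
rewrite /expi mulrDr cosD sinD; apply/eqP; rewrite eq_complex /= eqxx /=.
by rewrite [X in X == _]addrC.
Qed.

Lemma expi0 : expi 0 = 1 :> Cx R.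
Proof. by rewrite /expi mulr0 cos0 sin0. Qed.

Lemma expi_neq0 a : expi a != 0.
Proof.
apply/eqP => E; have := expiD a (- a); rewrite subrr expi0 E mul0r => /eqP.
by rewrite oner_eq0.
Qed.

Lemma expiN a : expi (- a) = (expi a)^-1.
Proof.
apply: (mulfI (expi_neq0 a)); rewrite -expiD subrr expi0 mulfV //.
exact: expi_neq0.
Qed.

Lemma expiB a b : expi (a - b) = expi a / expi b.
Proof. by rewrite expiD expiN. Qed.

(** Multiplying by [1 - u k] appends a negated copy of all terms with the exponent of [u k] raised
    by one. *)
Lemma laurent_prod n (K : seq 'I_n) : exists f : laurent n,
  forall u : 'I_n -> Cx R, (forall i, u i != 0) ->
    leval f u = \prod_(k <- K) (1 - u k).
Proof.
elim: K => [|k K [f fE]].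
  exists [:: (1, 0)] => u u0.
  by rewrite /leval big_seq1 big_nil mul1r big1 // => i _; rewrite mxE expr0z.
exists (f ++ [seq (- t.1, t.2 + delta_mx 0 k) | t <- f]) => u u0.
rewrite big_cons -fE // /leval big_cat big_map /= mulrBl mul1r; congr (_ + _).
rewrite mulr_sumr -sumrN; apply: eq_bigr => t _.
rewrite rmorphN mulNr mulrCA; congr (- (_ * _)).
under eq_bigr => i _ do rewrite mxE expfzDr //.
rewrite big_split /= mulrC; congr (_ * _).
rewrite (bigD1 k) //= mxE !eqxx expr1z big1 ?mulr1 // => i /negPf ik.
by rewrite mxE ik andbF expr0z.
Qed.

(* Since N lies among the positive weights, only the fixed points of CP^l
   outside N contribute, and they give the pushforward of 1 from CP^(l - |N|). *)
Lemma localization_sum n (l : nat) (N : {set 'I_n}) (f : laurent n)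
    (s0 : R) (s : 'I_n -> R) :
  (forall k, k \in N -> (k < l)%N) ->
  (forall u : 'I_n -> Cx R, (forall i, u i != 0) ->
    leval f u = \prod_(k in N) (1 - u k)) ->
  den0 l s0 s != 0 -> (forall j : 'I_n, (j < l)%N -> denj l s0 s j != 0) ->
  loc0 l f s0 s / den0 l s0 s +
    \sum_(j < n | (j < l)%N) locj l f s j / denj l s0 s j = 1.
Proof.
move=> Nl fE d0 dj.
have split_prod (G : 'I_n -> Cx R) (P : pred 'I_n) :
    \prod_(k < n | (k < l)%N && P k) G k =
    \prod_(k in N | P k) G k * \prod_(k < n | [&& (k < l)%N, k \notin N & P k]) G k.
  rewrite (bigID (mem N)) /=; congr (_ * _); apply: eq_bigl => k.
    by have := Nl k; case: (k \in N); rewrite ?andbF ?andbT // => ->.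
  by rewrite andbAC andbA.
have y00 : forall k : 'I_n, (k < l)%N -> 1 - expi (s k + s0) != 0.
  by move=> k kl; move/prodf_neq0: d0; apply.
have yk0 : forall j k : 'I_n, (j < l)%N -> (k < l)%N -> k != j ->
    1 - expi (s k - s j) != 0.
  move=> j k jl kl kj; have := dj j jl; rewrite mulf_eq0 negb_or => /andP[_].
  by move=> /prodf_neq0; apply; rewrite kl.
(* The fixed points of the projective space become nodes: [ord0] gets [expi (- s0)], so that the
   factors [1 - y k / y i] are those of [den0] and [denj]. The set [A] keeps the fixed points
   outside [N]. *)
pose y (i : 'I_n.+1) : Cx R :=
  oapp (fun k => expi (s k)) (expi (- s0)) (unlift ord0 i).
pose A := [set i : 'I_n.+1 |
  oapp (fun k : 'I_n => (k < l)%N && (k \notin N)) true (unlift ord0 i)].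
have y0 i : y i != 0 by rewrite /y; case: unlift => *; exact: expi_neq0.
have yE i j : 1 - y i / y j != 0 -> y i != y j.
  by apply: contra_neq => ->; rewrite mulfV ?subrr.
have inj_y : {in A &, injective y}.
  move=> i j iA jA /eqP; apply: contraTeq => ij; move: iA jA ij; rewrite !inE.
  case: (unliftP ord0 i) => [i' ->|->]; case: (unliftP ord0 j) => [j' ->|->];
    rewrite /= ?(inj_eq (@lift_inj _ ord0)).
  - move=> /andP[il _] /andP[jl _] ij; apply: yE.
    by rewrite /y !liftK /= -expiB yk0.
  - move=> /andP[il _] _ _; apply: yE.
    by rewrite /y liftK unlift_none /= -expiB opprK y00.
  - move=> _ /andP[jl _] _; rewrite eq_sym; apply: yE.
    by rewrite /y liftK unlift_none /= -expiB opprK y00.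
  - by rewrite eqxx.
have A0 : ord0 \in A by rewrite inE unlift_none.
rewrite -[RHS](sum_prod_inv_nodes A0 (fun i _ => y0 i) inj_y).
rewrite [RHS]big_mkcond big_ord_recl /= A0; congr (_ + _).
  rewrite [RHS]big_mkcond big_ord_recl /= andbF mul1r -big_mkcond /=.
  rewrite /loc0 fE => [|i]; last by case: ifP => _; exact: expi_neq0.
  have E : den0 l s0 s = \prod_(k in N) (1 - expi (s k + s0)) *
      \prod_(k < n | (k < l)%N && (k \notin N)) (1 - expi (s k + s0)).
    transitivity (\prod_(k < n | (k < l)%N && true) (1 - expi (s k + s0))).
      by apply: eq_bigl => k; rewrite andbT.
    rewrite (split_prod _ xpredT); congr (_ * _); apply: eq_bigl => k.
      by rewrite andbT.
    by rewrite !andbT.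
  (* The factors of the numerator cancel those of the denominator indexed by [N]. *)
  rewrite E invfM mulrA -prodfV -big_split /= big1.
    rewrite mul1r -prodfV; apply: eq_big => k; first by rewrite inE liftK /= andbT.
    by move=> _; rewrite /y liftK unlift_none /= -expiB opprK.
  by move=> k kN; rewrite (Nl _ kN) [s0 + _]addrC mulfV // y00 // Nl.
rewrite [LHS]big_mkcond; apply: eq_bigr => j _; rewrite inE liftK /=.
case: ifP => // jl; rewrite /locj fE => [|i]; last by case: ifP => _; exact: expi_neq0.
(* For [j] in [N] the numerator contains the factor [1 - expi 0]. *)
have [jN|jN] := boolP (j \in N).
  rewrite (bigD1 j) //= jl subrr expi0 subrr !mul0r //.
rewrite [RHS]big_mkcond big_ord_recl /= A0 /= /y liftK unlift_none /= -expiB.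
rewrite /denj invfM mulrCA [s j + s0]addrC -opprD; congr (_ * _).
rewrite (split_prod (fun k => 1 - expi (s k - s j)) (fun k => k != j)).
rewrite invfM mulrA -prodfV.
have -> : \prod_(k in N) (1 - (if (k < l)%N then expi (s k - s j) else expi (s k)))
   = \prod_(k in N | k != j) (1 - expi (s k - s j)).
  apply: eq_big => k; last by move=> /Nl ->.
  by have [->|] := eqVneq k j; rewrite ?(negPf jN) ?andbT.
rewrite -big_split big1 ?mul1r /=; last first.
  by move=> k /andP[kN kj]; rewrite mulfV // yk0 // Nl.
rewrite -prodfV big_mkcond; apply: eq_bigr => k _.
rewrite inE liftK /= (inj_eq (@lift_inj _ ord0)) -andbA -expiB //.
Qed.
End Exponential.

(** * Symplectic toric manifolds *)

Lemma fsbig_set (A : Type) (idx : A) (op : Monoid.com_law idx)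
    (I : finType) (K : {set I}) (F : I -> A) :
  \big[op/idx]_(i \in [set` K]%classic) F i = \big[op/idx]_(i in K) F i.
Proof.
rewrite [RHS](@bigfs _ _ op _ _ (mem K)) ?index_enum_uniq // => i _.
by rewrite mem_index_enum.
Qed.

Lemma fsbig_imset (A : Type) (idx : A) (op : Monoid.com_law idx)
    (I : finType) (T : choiceType) (f : I -> T) (K : {set I}) (F : T -> A) :
  injective f ->
  \big[op/idx]_(x \in [set f i | i in [set` K]]%classic) F x =
  \big[op/idx]_(i in K) F (f i).
Proof.
move=> inj_f; rewrite fsbig_image ?fsbig_set // => i j _ _; exact: inj_f.
Qed.

Lemma card_fset_set_image (I : finType) (T : choiceType) (f : I -> T)
    (K : {set I}) : injective f ->
  #|` fset_set [set f i | i in [set` K]]%classic|%fset = #|K|.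
Proof.
move=> inj_f; rewrite cardE -(size_map f).
apply: perm_size; apply: uniq_perm => [||x]; rewrite ?fset_uniq //.
  by rewrite (map_inj_uniq inj_f) enum_uniq.
rewrite in_fset_set; last exact/finite_image/finite_finset.
apply/idP/mapP => [|[i iK ->]].
  by rewrite classical_sets.inE => -[i /= iK <-]; exists i; rewrite ?mem_enum.
by rewrite classical_sets.inE /=; exists i => //; rewrite -mem_enum.
Qed.

(** Enumerates [K] and then its complement; the local index wants the positive weights first. *)
Lemma exists_bij_first n (K : {set 'I_n}) : exists2 sigma : 'I_n -> 'I_n,
  bijective sigma & forall k : 'I_n, (k < #|K|)%N = (sigma k \in K).
Proof.
have sz : size (enum K ++ enum (~: K)) == n.
  by rewrite size_cat -!cardE cardsC card_ord.
exists (tnth (Tuple sz)) => [|k].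
  apply: injF_bij; apply/tuple_uniqP; rewrite /= cat_uniq !enum_uniq andbT /=.
  apply/hasPn => k; rewrite /= !mem_enum inE //.
rewrite (tnth_nth k) /= nth_cat -cardE; case: ltnP => kK.
  by rewrite -mem_enum mem_nth // -cardE.
apply/esym/negbTE; rewrite -in_setC -mem_enum mem_nth //.
rewrite -cardE -(ltn_add2l #|K|) subnKC // cardsC card_ord.
exact: ltn_ord.
Qed.

Section Toric.
Variables (R : realType) (n : nat) (X : symplectic_toric_manifold R n).
Variables (J : acs_field X) (hX : toric_background J).
Implicit Types p q r : mspace X.
Local Notation V := (fset_set (fixedpt X)).

Lemma fixedV (v : V) : fixedpt X (val v).
Proof.
have := valP v; rewrite in_fset_set ?classical_sets.inE //.
exact: fixedpt_finite hX.
Qed.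

Lemma fixed_val q : fixedpt X q -> exists v : V, val v = q.
Proof.
move=> fq; have qV : q \in V.
  rewrite in_fset_set ?classical_sets.inE //; exact: fixedpt_finite hX.
by exists [` qV]%fset.
Qed.

Definition vtx (v : V) : 'rV[R]_n := psi (val v).

Lemma range_psi : range (@psi _ _ X) = hull vtx.
Proof.
rewrite (psi_convex_hull hX); have fin := fixedpt_finite hX.
apply/seteqP; split=> x /= [c [c0 c1 xE]].
  exists (c \o val); split=> [s||]; first exact: c0.
    by rewrite -c1 fsbig_finite //= big_seq_fsetE.
  by rewrite xE fsbig_finite //= big_seq_fsetE.
exists (fun q => oapp c 0 (insub q)); split=> [q||].
- by case: insub.
- rewrite -c1 fsbig_finite //= big_seq_fsetE /=.
  by apply: eq_bigr => s _; rewrite valK.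
- rewrite xE fsbig_finite //= big_seq_fsetE /=.
  by apply: eq_bigr => s _; rewrite valK.
Qed.

(** * Edges of the moment polytope and their weights *)

Lemma edge_sym r q : edge r q -> edge q r.
Proof.
move=> [fr fq rq F]; split=> //; first by move/esym.
by rewrite seg_sym.
Qed.

Lemma weights_neq0 q w : fixedpt X q -> weights J q w -> w != 0.
Proof.
move=> fq; have [B [Bu ->]] := weights_basis hX fq => -[k _ <-].
apply/eqP => /(congr1 (fun v => v *m invmx B)).
rewrite -row_mul mulmxV // mul0mx => /rowP /(_ k).
by rewrite !mxE eqxx => /eqP; rewrite oner_eq0.
Qed.

(** The edge weight is an isotropy weight at [q], hence nonzero, so it is not the default value of
    [xget]. *)
Lemma edge_weightP r q : edge r q ->
  exists2 m : R, 0 < m & psi q - psi r = m *: intv R (edge_weight r q).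
Proof.
move=> e; have [_ fq _ _] := e.
have : weights J q (edge_weight r q) by rewrite (weights_edges hX fq); exists r.
move=> /(weights_neq0 fq); rewrite /edge_weight.
by case: xgetP => [w _ [_ [m [m0 E]]] _|_]; [exists m|rewrite eqxx].
Qed.

(** Both ends lie on one ray from [psi q]. If their distances differed, the nearer one would lie
    strictly inside a segment of the polytope, yet it is a vertex. *)
Lemma edge_weight_inj r r' q : edge r q -> edge r' q ->
  edge_weight r q = edge_weight r' q -> r = r'.
Proof.
have main s s' (m m' : R) w : edge s q -> edge s' q -> 0 < m -> m < m' ->
    psi q - psi s = m *: w -> psi q - psi s' = m' *: w -> False.
  move=> [fs fq qs _] [fs' _ _ _] m0 mm' E E'.
  have m'0 : 0 < m' by apply: lt_trans mm'.
  have [_ F] := psi_fixedpt_vertex hX fs.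
  have /F H : range (@psi _ _ X) (psi q) by exists q.
  have /H {}H : range (@psi _ _ X) (psi s') by exists s'.
  have : 0 < m / m' < 1 by rewrite divr_gt0 // ltr_pdivrMr // mul1r.
  move=> /H [] /=; last by move=> /esym.
  have -> : psi s' = psi q - m' *: w by rewrite -E' subKr.
  rewrite scalerBr scalerBl scale1r scalerA divfK ?gt_eqF // -E.
  by rewrite addrA subrK subKr.
move=> e e' eqw; have [fr fq _ _] := e; have [fr' _ _ _] := e'.
have [m m0 E] := edge_weightP e; have [m' m'0 E'] := edge_weightP e'.
rewrite -eqw in E'; have [lt|lt|eqm] := ltgtP m m'.
- by case: (main _ _ _ _ _ e e' m0 lt E E').
- by case: (main _ _ _ _ _ e' e m'0 lt E' E).
apply: (psi_fixedpt_inj hX) => //; rewrite eqm -E' in E.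
by move: E => /addrI /oppr_inj.
Qed.

(** A numbering of the edges at each vertex that matches the rows of an integral basis of
    weights. *)
Record toric_graph (B : V -> 'M[int]_n) (nb : V -> 'I_n -> V) : Prop :=
  ToricGraph {
  tg_unit : forall v, B v \in unitmx;
  tg_weights : forall v, weights J (val v) = range (fun k => row k (B v));
  tg_edge : forall v k, edge (val (nb v k)) (val v);
  tg_weight : forall v k, edge_weight (val (nb v k)) (val v) = row k (B v);
  tg_nb : forall v r, edge r (val v) -> exists k, val (nb v k) = r }.

Lemma toric_graph_exists : exists B nb, toric_graph B nb.
Proof.
have [B hB] := choice (fun v => weights_basis hX (fixedV v)).
have nbP (vk : V * 'I_n) : exists s : V, edge (val s) (val vk.1) /\
    edge_weight (val s) (val vk.1) = row vk.2 (B vk.1).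
  case: vk => v k /=.
  have : weights J (val v) (row k (B v)) by rewrite (hB v).2; exists k.
  rewrite (weights_edges hX (fixedV v)) => -[r /= e ew].
  have [fr _ _ _] := e; have [s sr] := fixed_val fr.
  by exists s; rewrite sr.
have [nb hnb] := choice nbP.
exists B, (fun v k => nb (v, k)); split.
- by move=> v; case: (hB v).
- by move=> v; case: (hB v).
- by move=> v k; case: (hnb (v, k)).
- by move=> v k; case: (hnb (v, k)).
move=> v r e; have : weights J (val v) (edge_weight r (val v)).
  by rewrite (weights_edges hX (fixedV v)); exists r.
rewrite (hB v).2 => -[k _ wE]; exists k; have [ek wk] := hnb (v, k).
by apply: edge_weight_inj ek e _; rewrite wk /= wE.
Qed.

(** * The moment polytope as a simple polytope *)

Variables (B : V -> 'M[int]_n) (nb : V -> 'I_n -> V).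
Hypothesis tg : toric_graph B nb.

Lemma row_inj v : injective (fun k => row k (B v)).
Proof.
move=> j k /(congr1 (fun u => u *m invmx (B v))).
rewrite -!row_mul mulmxV ?(tg_unit tg) // => /rowP /(_ j).
by rewrite !mxE eqxx; case: eqP => // _ /eqP; rewrite oner_eq0.
Qed.

Lemma vtx_nb v k : exists2 m : R, 0 < m &
  vtx v - vtx (nb v k) = m *: intv R (row k (B v)).
Proof. by rewrite -(tg_weight tg); apply/edge_weightP/(tg_edge tg). Qed.

Lemma edge_len_exists : exists m : V -> 'I_n -> R, forall v k, 0 < m v k /\
  vtx v - vtx (nb v k) = m v k *: intv R (row k (B v)).
Proof.
have mP (vk : V * 'I_n) : exists m : R, 0 < m /\
    vtx vk.1 - vtx (nb vk.1 vk.2) = m *: intv R (row vk.2 (B vk.1)).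
  by have [m] := vtx_nb vk.1 vk.2; exists m.
have [m hm] := choice mP.
by exists (fun v k => m (v, k)) => v k; exact: hm (v, k).
Qed.

(** The edge vectors are the weights in the rows of [B v], scaled by positive lengths. *)
Lemma toric_edge_mx_unit v : edge_mx vtx nb v \in unitmx.
Proof.
have [m hm] := edge_len_exists.
have -> : edge_mx vtx nb v = diag_mx (\row_k m v k) *m map_mx intr (B v).
  apply/row_matrixP => k; rewrite rowK (hm v k).2 row_mul row_diag_mx mxE.
  by rewrite -scalemxAl -rowE; congr (_ *: _); apply/rowP => j; rewrite !mxE.
rewrite unitmx_mul !unitmxE det_diag det_map_mx rmorph_unit -?unitmxE ?(tg_unit tg) //.
rewrite andbT unitfE; apply/prodf_neq0 => k _.
by rewrite mxE gt_eqF // (hm v k).1.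
Qed.

(** Nonnegativity of the [k]-th coordinate at [v] defines a convex cone containing the edge vectors
    at [v], so [edges_generate] gives it for all vertices. *)
Lemma toric_simple_polytope : simple_polytope vtx nb.
Proof.
have Eu := toric_edge_mx_unit.
split=> // [v s k|v k]; last first.
  have [j jE] := tg_nb tg (edge_sym (tg_edge tg v k)); exists j.
  exact: val_inj.
have face_v : is_face (hull vtx) [set vtx v]%classic.
  by rewrite -range_psi; apply: (psi_fixedpt_vertex hX); exact: fixedV.
rewrite /coord -opprB mulNmx.
apply: (edges_generate face_v
  (K := fun x => 0 <= (- (x *m invmx (edge_mx vtx nb v))) 0 k)).
- by rewrite mul0mx oppr0 mxE.
- by move=> x y hx hy; rewrite mulmxDl opprD mxE addr_ge0.
- by move=> t x t0 hx; rewrite -scalemxAl -scalerN mxE mulr_ge0.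
move=> r rv F; have e : edge (val r) (val v).
  by split; rewrite ?range_psi //; exact: fixedV.
have [j /val_inj <-] := tg_nb tg e.
have -> : - ((vtx (nb v j) - vtx v) *m invmx (edge_mx vtx nb v)) = row j 1%:M.
  rewrite -mulNmx opprB -(mulmxV (Eu v)) row_mul; congr (_ *m _).
  by rewrite rowK.
by rewrite !mxE ler0n.
Qed.

(** * The generic component and the flow-up *)

Variables (xib : 'rV[R]_n) (hxib : generic J xib).
Let xi := xib^T.

(** The edge vector pointing towards [v] is a positive multiple of the weight at [v]. *)
Lemma mem_down v k : (k \in down vtx nb xi v) = (0 < wdot (row k (B v)) xib).
Proof.
have [m m0 E] := vtx_nb v k; rewrite inE -subr_gt0 -linB E.
by rewrite /lin -scalemxAl mxE pmulr_rgt0.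
Qed.

Lemma pos_weightsE v :
  pos_weights J xib (val v) =
  [set row k (B v) | k in [set` down vtx nb xi v]]%classic.
Proof.
rewrite /pos_weights (tg_weights tg); apply/seteqP; split=> w /=.
  by move=> [[k _ <-]] w0; exists k => //=; rewrite mem_down.
by move=> [k /=]; rewrite mem_down => kd <-; split=> //; exists k.
Qed.

Lemma neg_weightsE v :
  neg_weights J xib (val v) =
  [set row k (B v) | k in [set` ~: down vtx nb xi v]]%classic.
Proof.
rewrite /neg_weights (tg_weights tg); apply/seteqP; split=> w /=.
  by move=> [[k _ <-]] w0; exists k => //=; rewrite inE mem_down -leNgt ltW.
move=> [k /=]; rewrite inE mem_down -leNgt => kd <-; split; first by exists k.
rewrite lt_neqAle kd andbT; apply: (hxib.1 _ _ (fixedV v)).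
by rewrite (tg_weights tg); exists k.
Qed.

Lemma lambdaE v : lambda J xib (val v) = #|down vtx nb xi v|.
Proof. by rewrite /lambda pos_weightsE card_fset_set_image //; exact: row_inj. Qed.

Lemma mu_inj : injective (fun s => lin xi (vtx s)).
Proof.
move=> s t /(hxib.2 _ _ (fixedV s) (fixedV t)); exact: val_inj.
Qed.

Lemma index_increasing_card : index_increasing J xib ->
  forall s k, k \in down vtx nb xi s ->
    (#|down vtx nb xi (nb s k)| < #|down vtx nb xi s|)%N.
Proof.
move=> hinc s k; rewrite -!lambdaE inE => kd; apply: hinc kd; exact: (tg_edge tg).
Qed.

Lemma ordered_weights (v : V) : exists sigma : 'I_n -> 'I_n,
  [/\ bijective sigma,
      injective (fun k => row (sigma k) (B v)) /\
        range (fun k => row (sigma k) (B v)) = weights J (val v),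
      forall k : 'I_n, (k < lambda J xib (val v))%N = (sigma k \in down vtx nb xi v) &
      forall k : 'I_n, (k < lambda J xib (val v))%N <->
        pos_weights J xib (val v) (row (sigma k) (B v))].
Proof.
have [sigma bij sigmaE] := exists_bij_first (down vtx nb xi v).
have [tau sigmaK tauK] := bij.
exists sigma; split=> // [|k|k].
- split; first exact: inj_comp (row_inj (v := v)) (bij_inj bij).
  rewrite (tg_weights tg); apply/seteqP; split=> _ [k _ <-]; first by exists (sigma k).
  by exists (tau k) => //; rewrite tauK.
- by rewrite lambdaE sigmaE.
rewrite lambdaE sigmaE mem_down; split=> [w0|[]//]; split=> //.
by rewrite (tg_weights tg); exists (sigma k).
Qed.

(** Negative weights belong to ascending edges, so the flow-up corresponds to the face these span at
    [v]. *)
Definition flow_fun v := span_fun vtx nb v (~: down vtx nb xi v).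

(** Both sides say that the coordinates of [s] at [v] along the descending edges vanish. *)
Lemma flow_upE v s :
  flow_up J xib (val v) (val s) <-> face_of vtx (flow_fun v) s.
Proof.
have P := toric_simple_polytope; have [m hm] := edge_len_exists.
have reE (c : 'rV[int]_n -> R) :
    \sum_(w \in neg_weights J xib (val v)) c w *: intv R w =
    \sum_(k in ~: down vtx nb xi v) c (row k (B v)) *: intv R (row k (B v)).
  by rewrite neg_weightsE fsbig_imset //; exact: row_inj.
split=> [[c]|].
  rewrite reE => E; apply/(span_funP P) => k; rewrite inE negbK => kd.
  rewrite (coord_uniq P (a := fun k => if k \in down vtx nb xi v then 0 else
     - (c (row k (B v)) / m v k))) ?kd //.
  rewrite -[psi _]/(vtx s) -[psi _]/(vtx v) in E.
  rewrite E opprD addNKr -sumrN big_mkcond; apply: eq_bigr => j _.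
  rewrite inE; case: ifP => [/negPf ->|]; last first.
    by move=> /negbT; rewrite negbK => ->; rewrite scale0r.
  by rewrite (hm v j).2 scalerA mulNr divfK ?scaleNr // gt_eqF // (hm v j).1.
move=> /(span_funP P) h.
(* [pick] recovers the edge from its weight, [m v k] turns edge vectors into weights, and the sign
   is there because [coord] expands [vtx v - vtx s]. *)
exists (fun w => if [pick k | row k (B v) == w] is Some k
  then - (coord vtx nb v s 0 k * m v k) else 0).
rewrite reE -/(vtx v) -/(vtx s); apply/eqP; rewrite -subr_eq0 opprD addrA.
rewrite -[vtx s - vtx v]opprB -opprD oppr_eq0 (coordE P).
rewrite [X in _ + X]big_mkcond -big_split /=.
apply/eqP/big1 => k _; case: ifP => kd; last first.
  by rewrite h ?kd // scale0r addr0.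
case: pickP => [j /eqP /row_inj ->|/(_ k)]; last by rewrite eqxx.
by rewrite (hm v k).2 scalerA scaleNr subrr.
Qed.

Lemma flow_fun_self v : face_of vtx (flow_fun v) v.
Proof. exact: span_fun_self toric_simple_polytope _ _. Qed.

Lemma flow_fun_dirs v : face_dirs vtx nb (flow_fun v) v = ~: down vtx nb xi v.
Proof. exact: span_fun_dirs toric_simple_polytope _ _. Qed.

(** No edge of the flow-up descends at [v]. This gives the vanishing below [p] required of a Kirwan
    class. *)
Lemma flow_up_min (v s : V) :
  flow_up J xib (val v) (val s) -> mu xib (val v) <= mu xib (val s).
Proof.
move=> /flow_upE Fs.
apply: (face_min toric_simple_polytope (flow_fun_self v) Fs).
by rewrite flow_fun_dirs setIC setICr.
Qed.

(** The neighbours of [s] off the flow-up are those reached along directions outside the face. *)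
Lemma normal_edges_prod (v s : V) (zeta : 'rV[R]_n) : 
  \big[*%R/1]_(r \in [set r | [/\ fixedpt X r, ~ flow_up J xib (val v) r
                                & edge r (val s)]]%classic)
    (1 - chi (edge_weight r (val s)) zeta) =
  \prod_(k in ~: face_dirs vtx nb (flow_fun v) s) (1 - chi (row k (B s)) zeta).
Proof.
have -> : [set r | [/\ fixedpt X r, ~ flow_up J xib (val v) r
                                & edge r (val s)]]%classic =
  [set val (nb s k) | k in [set` ~: face_dirs vtx nb (flow_fun v) s]]%classic.
  apply/seteqP; split=> r /=.
    move=> [_ nF e]; have [k kE] := tg_nb tg e; exists k => //=.
    by rewrite !inE; apply/negP => /flow_upE; rewrite kE.
  move=> [k /=]; rewrite !inE => /negP nF <-; split.
  - exact: fixedV.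
  - by move=> /flow_upE.
  - exact: (tg_edge tg).
rewrite fsbig_imset; last first.
  move=> j k /val_inj; exact: nb_inj toric_simple_polytope _ _ _.
by apply: eq_bigr => k _; rewrite (tg_weight tg).
Qed.
End Toric.

Theorem proposition3p5 (R : realType) (n : nat)
    (X : symplectic_toric_manifold R n)
    (J : acs_field X) (hJ : invariant_compatible_acs J)
    (hX : toric_background J)
    (xib : 'rV[R]_n) (hxib : generic J xib)
    (hinc : index_increasing J xib)
    (p : mspace X) (hp : fixedpt X p)
    (eta : kclass X) (heta : is_poincare_dual J xib p eta) :
  is_icanonical J xib p eta.
Proof.
have [v vp] := fixed_val hX hp; rewrite -{p hp}vp in heta *.
have [B [nb tg]] := toric_graph_exists hX.
have [etaK eta0 etaF] := heta.
have P := toric_simple_polytope hX tg.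
have Fv := flow_fun_self hX tg xib v.
have flowE := flow_upE hX tg hxib v.
split.
(* At [p] the edges normal to the flow-up are exactly the descending ones, which carry the positive
   weights. *)
- split=> // [zeta|q zeta fq lt].
    rewrite etaF; [|exact: fixedV hX _|exact/flowE].
    rewrite (normal_edges_prod hX tg hxib) (flow_fun_dirs hX tg) setCK.
    rewrite (pos_weightsE hX tg) fsbig_imset //; exact: row_inj tg _.
  have [s sq] := fixed_val hX fq; rewrite -sq in fq lt *.
  apply: eta0 => // /(flow_up_min hX tg hxib).
  by rewrite leNgt lt.
- move=> q fq Fq; have [s sq] := fixed_val hX fq; rewrite -{q}sq in fq Fq *.
  have /flowE Fs := Fq.
  (* All edges at [s] normal to the flow-up descend, so every factor of [eta] there comes from a
     positive weight. *)
  have nd := normal_dirs_down P (mu_inj hX hxib)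
    (index_increasing_card hX tg hinc) Fv (flow_fun_dirs hX tg xib v) Fs.
  have [sigma [sigma_bij w_inj lE w_pos]] := ordered_weights hX tg xib s.
  pose N := [set k | sigma k \notin face_dirs (@vtx _ _ X) nb (flow_fun nb xib v) s].
  have [f fE] := laurent_prod R (enum N).
  have Nl k : k \in N -> (k < lambda J xib (val s))%N.
    rewrite lE inE => kN.
    by apply: (subsetP nd); rewrite inE.
  have {}fE (u : 'I_n -> Cx R) : (forall i, u i != 0) ->
      leval f u = \prod_(k in N) (1 - u k).
    by move=> /fE ->; rewrite big_enum.
  (* The pushforward is the constant Laurent polynomial 1: one term with coefficient 1 and exponent
     0. *)
  exists (fun k => row (sigma k) (B s)), f, [:: (1, 0)] => s' hval.
  have hval1 z zeta : hval z zeta = 1.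
    rewrite /hval /leval big_seq1 mul1r big1 // => i _.
    by rewrite mxE expr0z.
  split.
  + exact: w_inj.
  + exact: w_pos.
  + move=> zeta; rewrite fE => [|i]; last exact: expi_neq0.
    rewrite etaF // (normal_edges_prod hX tg hxib).
    rewrite (reindex sigma) /=; last exact: onW_bij.
    by apply: eq_bigl => k; rewrite !inE.
  + move=> s0 zeta d0 dj; rewrite hval1; apply/esym.
    by apply: (localization_sum (N := N)) => //; exact: Nl.
  + by move=> zeta; rewrite hval1.
- move=> q fq nFq; have [s sq] := fixed_val hX fq; rewrite -{q}sq in fq nFq *.
  have [sigma [sigma_bij w_inj lE w_pos]] := ordered_weights hX tg xib s.
  (* Off the flow-up [eta] vanishes, so both Laurent polynomials are empty sums. *)
  exists (fun k => row (sigma k) (B s)), [::], [::] => s' hval.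
  split.
  + exact: w_inj.
  + exact: w_pos.
  + by move=> zeta; rewrite eta0 // /leval big_nil.
  + move=> s0 zeta d0 dj; rewrite /hval /loc0 /leval !big_nil mul0r add0r.
    by rewrite big1 // => j _; rewrite /locj /leval big_nil mul0r.
  + by move=> zeta; rewrite /hval /leval big_nil.
Qed.
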